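(* There is an algorithm that solves any instance $(I,\varepsilon)$ of SSR$_L$ with $|I| = n$ in time $O(\mathrm{poly}(n)\cdot 1/\varepsilon^{0.93856})$.
   Context: $\Sigma(Z)$ is the sum of the elements of $Z$. $R(X,Y) := \max\{\Sigma(X)/\Sigma(Y), \Sigma(Y)/\Sigma(X)\}$, convention $x/0=\infty$ for $x\ge 0$. $\mathrm{OPT}_L(J) := \min\{R(X,Y)\mid X,Y\subseteq J\text{ disjoint}, \max(J)\in X\cup Y\}$. SSR$_L$: given a set $I\subset\mathbb{R}_{>0}$ of size $n\ge 2$ and $\varepsilon\in(0,1)$, compute disjoint $X,Y\subseteq I$ (not necessarily containing $\max(I)$) with $R(X,Y)\le(1+\varepsilon)\mathrm{OPT}_L(I)$. Items are given sorted; the model is the Real RAM with constant-time arithmetic and floor. *)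

(* Defs.v *)
From HB Require Import structures.
From mathcomp Require Import all_boot all_order all_algebra finmap.
From mathcomp Require Import all_classical all_reals all_analysis.

Set Implicit Arguments.
Unset Strict Implicit.
Unset Printing Implicit Defensive.

Import Order.TTheory GRing.Theory Num.Theory.

Local Open Scope ring_scope.

Section SubsetSumRatio.
Variable R : realType.
Implicit Types (X Y Z J : {fset R}) (x y eps : R).

Definition Sigma Z : R := \sum_(z <- Z) z.

(* x / 0 = +oo, including 0 / 0; the division of \bar R has 0 / 0 = 0. *)
Definition ratio_div x y : \bar R := if y == 0 then +oo%E else (x / y)%:E.

Definition sum_ratio X Y : \bar R :=
  Order.max (ratio_div (Sigma X) (Sigma Y)) (ratio_div (Sigma Y) (Sigma X)).

(* The default value 0 is harmless for nonempty sets of positive numbers. *)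
Definition fset_max J : R := \big[Num.max/0]_(x <- J) x.

Definition OPT_L J : \bar R :=
  \big[Order.min/+oo%E]_(X <- fpowerset J)
    \big[Order.min/+oo%E]_(Y <- fpowerset J |
        [disjoint X & Y]%fset && (fset_max J \in X `|` Y)%fset) sum_ratio X Y.

Definition SSR_L_instance J eps : Prop :=
  [/\ forall x, x \in J -> 0 < x, (2 <= #|` J|)%N & 0 < eps < 1].

Definition SSR_L_solution J eps X Y : Prop :=
  [/\ (X `<=` J)%fset, (Y `<=` J)%fset, [disjoint X & Y]%fset
    & (sum_ratio X Y <= (1 + eps)%:E * OPT_L J)%E].

End SubsetSumRatio.

(* Real RAM: registers and memory cells hold reals; registers are addressed by
   constants, memory cells only indirectly, through the value of a register.
   Every instruction takes unit time. Only integer constants are available, so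
   that a program is a finite object. *)

Inductive arith_op := OpAdd | OpSub | OpMul | OpDiv.

Inductive instr :=
| IConst of nat & int                   (* r_i := z *)
| IArith of arith_op & nat & nat & nat  (* r_i := r_j op r_k *)
| IFloor of nat & nat                   (* r_i := floor r_j *)
| ILoad  of nat & nat                   (* r_i := M[r_j] *)
| IStore of nat & nat                   (* M[r_i] := r_j *)
| IJumpLe of nat & nat & nat            (* if r_i <= r_j then goto l *)
| IHalt.

Definition program := seq instr.

Section RealRAM.
Variable R : realType.

Record state := State { pc : nat; reg : nat -> R; memory : nat -> R }.

Definition upd (f : nat -> R) (i : nat) (v : R) : nat -> R :=
  fun j => if j == i then v else f j.

Definition arith (op : arith_op) (x y : R) : option R :=
  match op with
  | OpAdd => Some (x + y)
  | OpSub => Some (x - y)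
  | OpMul => Some (x * y)
  | OpDiv => if y == 0 then None else Some (x / y)
  end.

Definition address (x : R) : option nat :=
  if x \is a Num.nat then Some (Num.truncn x) else None.

(* None: the machine has halted, or it faults (division by zero, address that
   is not a natural number, program counter outside of the program). *)
Definition step (P : program) (s : state) : option state :=
  let: State p r m := s in
  match onth P p with
  | Some (IConst i z) => Some (State p.+1 (upd r i z%:~R) m)
  | Some (IArith op i j k) =>
      omap (fun v => State p.+1 (upd r i v) m) (arith op (r j) (r k))
  | Some (IFloor i j) => Some (State p.+1 (upd r i (Num.floor (r j))%:~R) m)
  | Some (ILoad i j) =>
      omap (fun a => State p.+1 (upd r i (m a)) m) (address (r j))
  | Some (IStore i j) =>
      omap (fun a => State p.+1 r (upd m a (r j))) (address (r i))
  | Some (IJumpLe i j l) => Some (State (if r i <= r j then l else p.+1) r m)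
  | Some IHalt | None => None
  end.

Fixpoint run (P : program) (t : nat) (s : state) : option state :=
  if t is t'.+1 then obind (run P t') (step P s) else Some s.

Definition halts_in (P : program) (s : state) (t : nat) (s' : state) : Prop :=
  run P t s = Some s' /\ onth P (pc s') = Some IHalt.

Definition items (J : {fset R}) : seq R := sort <=%R (enum_fset J).

(* Input: n in r_0, eps in r_1, the sorted items in M[0], ..., M[n - 1]. *)
Definition input (J : {fset R}) (eps : R) : state :=
  State 0%N (upd (upd (fun=> 0) 0%N #|` J|%:R) 1%N eps) (nth 0 (items J)).

(* Output: the i-th smallest item belongs to X iff M[i] != 0, and to Y iff
   M[n + i] != 0. *)
Definition outputX (J : {fset R}) (s : state) : {fset R} :=
  [fset x in J | memory s (index x (items J)) != 0]%fset.
Definition outputY (J : {fset R}) (s : state) : {fset R} :=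
  [fset x in J | memory s (#|` J| + index x (items J))%N != 0]%fset.

End RealRAM.

(* Main.v *)
Require Import Defs.
From HB Require Import structures.
From mathcomp Require Import all_boot all_order all_algebra finmap.
From mathcomp Require Import all_classical all_reals all_analysis.
From mathcomp Require Import zify lra ring.

(** Since arithmetic on arbitrarily large numbers has unit cost, a generating
    function can be stored in a single register, and SSR_L can be solved in time
    poly(n) * log(1/eps)^2, which is more than enough.

    If n times the second largest item is at most the maximum M, then {M}
    against all other items is optimal. Otherwise 1 <= OPT_L <= n, and we search
    for OPT_L by bisection down to an additive error eps/4. By symmetry M may be
    put into X. To test a ratio rho, round every item a to k = floor(K a) and
    l = floor(K rho a) + 1 with K = 4 n / (eps M). Up to a relative error of
    order eps, a pair (X, Y) has ratio at most rho iff
      d = sum_X l - sum_Y k  and  e = sum_Y l - sum_X k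
    are both nonnegative, and x^d y^e runs through the monomials of
      (x^l_M / y^k_M) * prod_(a <> M) (1 + x^l / y^k + y^l / x^k).
    This product is evaluated at y = 4^n and x = y^(2N+2), where N bounds |e|.
    The coefficients are at most 3^n < y, hence they do not interfere, and floor
    and reduction modulo x - 1 decide whether a monomial with d, e >= 0 occurs.
    A pair is extracted by deciding the items one after the other, keeping the
    test positive. The powers are computed by repeated squaring. *)

Set Implicit Arguments.
Unset Strict Implicit.
Unset Printing Implicit Defensive.

Import Order.TTheory GRing.Theory Num.Theory.

Local Open Scope ring_scope.

(** * A structured language compiled to the Real RAM *)

Inductive expr :=
| EReg of nat
| EInt of int
| EBin of arith_op & expr & expr
| EFloor of expr.

Inductive cmd :=
| CSet of nat & expr
| CLoad of nat & expr
| CStore of expr & expr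
| CSeq of cmd & cmd
| CIf of expr & expr & cmd & cmd
| CWhile of expr & expr & cmd.

(* Registers [tmp], [tmp + 1], ... hold intermediate values of expressions. *)
Definition tmp := 40%N.
Arguments tmp : simpl never.

Fixpoint wf_expr e : bool :=
  match e with
  | EReg i => (i < tmp)%N
  | EInt _ => true
  | EBin _ a b => wf_expr a && wf_expr b
  | EFloor a => wf_expr a
  end.

Fixpoint wf c : bool :=
  match c with
  | CSet v e | CLoad v e => (v < tmp)%N && wf_expr e
  | CStore a b => wf_expr a && wf_expr b
  | CSeq c1 c2 => wf c1 && wf c2
  | CIf a b c1 c2 => [&& wf_expr a, wf_expr b, wf c1 & wf c2]
  | CWhile a b c1 => [&& wf_expr a, wf_expr b & wf c1]
  end.

(** There is no move instruction, so a register is copied by adding it to 0. The result goes to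
    register [t]; the right operand is computed from [t.+1] on, so that the left one survives. *)
Fixpoint comp_expr (e : expr) (t : nat) : seq instr :=
  match e with
  | EReg i => [:: IConst t 0; IArith OpAdd t t i]
  | EInt z => [:: IConst t z]
  | EBin op a b => comp_expr a t ++ comp_expr b t.+1 ++ [:: IArith op t t t.+1]
  | EFloor a => comp_expr a t ++ [:: IFloor t t]
  end.

Definition comp_pair (a b : expr) := comp_expr a tmp ++ comp_expr b tmp.+1.

(** Jump targets are absolute, hence the load address [off]. [IJumpLe 0 0] compares a register with
    itself and is an unconditional jump. The else branch stands first and ends with a jump over the
    then branch. *)
Fixpoint compile (off : nat) (c : cmd) : seq instr :=
  match c with
  | CSet v e =>
      comp_expr e tmp ++ [:: IConst tmp.+1 0; IArith OpAdd v tmp tmp.+1]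
  | CLoad v e => comp_expr e tmp ++ [:: ILoad v tmp]
  | CStore a b => comp_pair a b ++ [:: IStore tmp tmp.+1]
  | CSeq c1 c2 =>
      let p1 := compile off c1 in p1 ++ compile (off + size p1) c2
  | CIf a b c1 c2 =>
      let h := comp_pair a b in
      let o2 := (off + size h).+1 in
      let p2 := compile o2 c2 in
      let o1 := (o2 + size p2).+1 in
      let p1 := compile o1 c1 in
      h ++ IJumpLe tmp tmp.+1 o1 :: p2 ++ IJumpLe 0 0 (o1 + size p1) :: p1
  | CWhile a b c1 =>
      let h := comp_pair a b in
      let o1 := (off + size h).+2 in
      let p1 := compile o1 c1 in
      h ++ IJumpLe tmp tmp.+1 o1 :: IJumpLe 0 0 (o1 + size p1).+1 ::
        p1 ++ [:: IJumpLe 0 0 off]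
  end.

(** Together with [storeless], this is the footprint used by the frame rule [ev_frame]. Temporary
    registers are invisible to the big-step semantics and do not count. *)
Fixpoint writes c : seq nat :=
  match c with
  | CSet v _ | CLoad v _ => [:: v]
  | CStore _ _ => [::]
  | CSeq c1 c2 | CIf _ _ c1 c2 => writes c1 ++ writes c2
  | CWhile _ _ c1 => writes c1
  end.

Fixpoint storeless c : bool :=
  match c with
  | CSet _ _ | CLoad _ _ => true
  | CStore _ _ => false
  | CSeq c1 c2 | CIf _ _ c1 c2 => storeless c1 && storeless c2
  | CWhile _ _ c1 => storeless c1
  end.

Local Arguments onth : simpl never.

Fixpoint code_at (P : program) (off : nat) (cs : seq instr) : Prop :=
  if cs is c :: cs' then onth P off = Some c /\ code_at P off.+1 cs' else True.

Lemma code_at_cat P off cs1 cs2 :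
  code_at P off (cs1 ++ cs2) <->
  code_at P off cs1 /\ code_at P (off + size cs1) cs2.
Proof.
elim: cs1 off => [|c cs1 IH] off /=; first by rewrite addn0; split=> // -[].
by rewrite IH addSnnS; split=> [[-> []]|[[-> ?] ?]].
Qed.

Lemma code_at_suffix pre cs post : code_at (pre ++ cs ++ post) (size pre) cs.
Proof.
elim: cs pre => //= c cs IH pre; split.
  by rewrite onth_cat ltnn subnn.
by have := IH (rcons pre c); rewrite size_rcons cat_rcons.
Qed.

(** * Big-step semantics, correctness of the compiler, and time-bounded program logic *)

Section Semantics.
Variable R : realType.
Implicit Types (r : nat -> R) (m : nat -> R).

Fixpoint denote (e : expr) r : R :=
  match e with
  | EReg i => r i
  | EInt z => z%:~R
  | EBin OpAdd a b => denote a r + denote b r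
  | EBin OpSub a b => denote a r - denote b r
  | EBin OpMul a b => denote a r * denote b r
  | EBin OpDiv a b => denote a r / denote b r
  | EFloor a => (Num.floor (denote a r))%:~R
  end.

(** In [denote] a quotient by 0 is 0, whereas the machine faults; this predicate rules the
    difference out. *)
Fixpoint edef (e : expr) r : bool :=
  match e with
  | EReg _ | EInt _ => true
  | EBin OpDiv a b => [&& edef a r, edef b r & denote b r != 0]
  | EBin _ a b => edef a r && edef b r
  | EFloor a => edef a r
  end.

Definition pair_cost a b := size (comp_pair a b).

(* Big-step semantics; the number is the running time of the compiled code. *)
Inductive ev : cmd -> (nat -> R) -> (nat -> R) ->
    nat -> (nat -> R) -> (nat -> R) -> Prop :=
| EvSet v e r m : edef e r ->
    ev (CSet v e) r m (size (comp_expr e tmp) + 2) (upd r v (denote e r)) m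
| EvLoad v e r m j : edef e r -> denote e r = j%:R ->
    ev (CLoad v e) r m (size (comp_expr e tmp) + 1) (upd r v (m j)) m
| EvStore a b r m j : edef a r -> edef b r -> denote a r = j%:R ->
    ev (CStore a b) r m (pair_cost a b + 1) r (upd m j (denote b r))
| EvSeq c1 c2 r m t1 r1 m1 t2 r2 m2 :
    ev c1 r m t1 r1 m1 -> ev c2 r1 m1 t2 r2 m2 ->
    ev (CSeq c1 c2) r m (t1 + t2) r2 m2
| EvIfT a b c1 c2 r m t r' m' : edef a r -> edef b r ->
    denote a r <= denote b r -> ev c1 r m t r' m' ->
    ev (CIf a b c1 c2) r m (pair_cost a b + (1 + t)) r' m'
| EvIfF a b c1 c2 r m t r' m' : edef a r -> edef b r ->
    denote b r < denote a r -> ev c2 r m t r' m' ->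
    ev (CIf a b c1 c2) r m (pair_cost a b + (1 + (t + 1))) r' m'
| EvWhileT a b c r m t r1 m1 t' r' m' : edef a r -> edef b r ->
    denote a r <= denote b r -> ev c r m t r1 m1 ->
    ev (CWhile a b c) r1 m1 t' r' m' ->
    ev (CWhile a b c) r m (pair_cost a b + (1 + (t + (1 + t')))) r' m'
| EvWhileF a b c r m : edef a r -> edef b r -> denote b r < denote a r ->
    ev (CWhile a b c) r m (pair_cost a b + 2) r m.

Lemma ev_frame c r m t r' m' : ev c r m t r' m' ->
  (forall i, i \notin writes c -> r' i = r i) /\ (storeless c -> m' = m).
Proof.
elim=> //= {c r m t r' m'}.
- move=> v e r m _; split=> // i; rewrite inE /upd => /negPf->//.
- move=> v e r m j _ _; split=> // i; rewrite inE /upd => /negPf->//.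
- move=> c1 c2 r m t1 r1 m1 t2 r2 m2 _ [IH1 IM1] _ [IH2 IM2]; split.
    by move=> i; rewrite mem_cat negb_or => /andP[/IH1<- /IH2->].
  by case/andP => /IM1<- /IM2->.
- move=> a b c1 c2 r m t r' m' _ _ _ _ [IH1 IM1]; split.
    by move=> i; rewrite mem_cat negb_or => /andP[/IH1<-].
  by case/andP => /IM1<-.
- move=> a b c1 c2 r m t r' m' _ _ _ _ [IH1 IM1]; split.
    by move=> i; rewrite mem_cat negb_or => /andP[_ /IH1<-].
  by case/andP => _ /IM1<-.
- move=> a b c r m t r1 m1 t' r' m' _ _ _ _ [IH1 IM1] _ [IH2 IM2]; split.
    by move=> i Hi; rewrite IH2 ?IH1.
  by move=> H; rewrite IM2 ?IM1.
Qed.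

Definition agree (t : nat) r r0 := forall i, (i < t)%N -> r0 i = r i.

Lemma agree_upd t r r0 v x : agree t r r0 -> agree t (upd r v x) (upd r0 v x).
Proof. by move=> H i Hi; rewrite /upd; case: eqP => // _; apply: H. Qed.

Lemma runD (P : program) t1 t2 (s s1 : state R) :
  run P t1 s = Some s1 -> run P (t1 + t2) s = run P t2 s1.
Proof.
elim: t1 s => [|t1 IH] s /=; first by case=> ->.
by case: (step P s) => //= s'; apply: IH.
Qed.

Lemma run1 (P : program) (s s1 : state R) :
  step P s = Some s1 -> run P 1 s = Some s1.
Proof. by move=> /= ->. Qed.

(** The source registers [r] and the machine registers [r0] agree only below [tmp]. The conclusion
    [agree t r0 r1] is stronger: it protects the temporaries below [t], among them a left operand
    waiting for the right one. *)
Lemma comp_expr_correct P e t off r r0 m : wf_expr e -> (tmp <= t)%N ->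
  edef e r -> agree tmp r r0 -> code_at P off (comp_expr e t) ->
  exists r1, [/\ run P (size (comp_expr e t)) (State off r0 m) =
                   Some (State (off + size (comp_expr e t)) r1 m),
                 r1 t = denote e r & agree t r0 r1].
Proof.
elim: e t off r0 => [i|z|op a IHa b IHb|a IHa] t off r0 /=.
- move=> Hi Ht _ Hag [H1 [H2 _]].
  rewrite H1 /= H2 /=; eexists; split; first by rewrite addn2.
    rewrite /upd eqxx ifN ?Hag //; last by lia.
    by rewrite add0r.
  by move=> j Hj; rewrite /upd !ifN //; lia.
- move=> _ Ht _ Hag [H1 _]; rewrite H1 /=; eexists; split.
  + by rewrite addn1.
  + by rewrite /upd eqxx.
  + by move=> j Hj; rewrite /upd ifN //; lia.
- case/andP=> wa wb Ht Hdef Hag.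
  rewrite !code_at_cat => -[Ca [Cb [C _]]].
  have da : edef a r by case: (op) Hdef => /andP[].
  have db : edef b r.
    by case: (op) Hdef => [/andP[]|/andP[]|/andP[]|/and3P[]].
  have [ra [Ra va Aa]] := IHa _ _ _ wa Ht da Hag Ca.
  have Haga : agree tmp r ra.
    by move=> i Hi; rewrite Aa ?Hag //; lia.
  have [rb [Rb vb Ab]] := IHb _ _ _ wb (leq_trans Ht (leqnSn t)) db Haga Cb.
  have vat : rb t = denote a r by rewrite Ab.
  exists (upd rb t (denote (EBin op a b) r)); split.
  + rewrite !size_cat (runD _ Ra) (runD _ Rb).
    apply: run1; rewrite /step C /= vat vb.
    case: (op) Hdef => //=; rewrite ?addn1 !addnA ?addnS ?addn0 //.
    by case/and3P => _ _ /negPf->.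
  + by rewrite /upd eqxx.
  + move=> j Hj; rewrite /upd ifN; last by lia.
    by rewrite Ab ?Aa //; lia.
- move=> wa Ht da Hag; rewrite code_at_cat => -[Ca [C _]].
  have [ra [Ra va Aa]] := IHa _ _ _ wa Ht da Hag Ca.
  exists (upd ra t (denote (EFloor a) r)); split.
  + rewrite size_cat (runD _ Ra); apply: run1.
    by rewrite /step C /= va addnA addn1.
  + by rewrite /upd eqxx.
  + by move=> j Hj; rewrite /upd ifN ?Aa //; lia.
Qed.

Lemma comp_pair_correct P a b off r r0 m : wf_expr a -> wf_expr b ->
  edef a r -> edef b r -> agree tmp r r0 -> code_at P off (comp_pair a b) ->
  exists r1, [/\ run P (pair_cost a b) (State off r0 m) =
                   Some (State (off + pair_cost a b) r1 m),
                 r1 tmp = denote a r, r1 tmp.+1 = denote b r & agree tmp r r1].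
Proof.
rewrite /pair_cost /comp_pair => wa wb da db Hag; rewrite code_at_cat => -[Ca Cb].
have [ra [Ra va Aa]] := comp_expr_correct m wa (leqnn _) da Hag Ca.
have Haga : agree tmp r ra by move=> i Hi; rewrite Aa ?Hag.
have [rb [Rb vb Ab]] := comp_expr_correct m wb (leqnSn _) db Haga Cb.
exists rb; split=> //.
- by rewrite size_cat (runD _ Ra) Rb addnA.
- by rewrite Ab.
- by move=> i Hi; rewrite Ab ?Haga // ltnW.
Qed.

Lemma address_nat j : address (j%:R : R) = Some j.
Proof. by rewrite /address natr_nat natrK. Qed.

(** Induction on the derivation rather than on the command: after one round of a loop, the second
    hypothesis applies to the same code at the same address. *)
Lemma compile_correct c r m t r' m' : ev c r m t r' m' -> wf c ->
  forall P off r0, code_at P off (compile off c) -> agree tmp r r0 ->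
  exists r0', run P t (State off r0 m) =
                Some (State (off + size (compile off c)) r0' m')
              /\ agree tmp r' r0'.
Proof.
elim=> {c r m t r' m'}.
- move=> v e r m de /= /andP[Hv we] P off r0.
  rewrite code_at_cat => -[Ce [C1 [C2 _]]] Hag.
  have [r1 [R1 v1 A1]] := comp_expr_correct m we (leqnn _) de Hag Ce.
  exists (upd (upd r1 tmp.+1 0) v (denote e r)); split.
    rewrite size_cat (runD _ R1) /= C1 /= C2 /= addnA addn2.
    by rewrite /upd /= v1 addr0.
  move=> i Hi; rewrite /upd; case: eqP => // _.
  by rewrite ifN ?A1 ?Hag //; lia.
- move=> v e r m j de ve /= /andP[Hv we] P off r0.
  rewrite code_at_cat => -[Ce [C1 _]] Hag.
  have [r1 [R1 v1 A1]] := comp_expr_correct m we (leqnn _) de Hag Ce.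
  exists (upd r1 v (m j)); split.
    by rewrite size_cat (runD _ R1) /= C1 /= v1 ve address_nat /= addnA addn1.
  by apply: agree_upd => i Hi; rewrite A1 ?Hag.
- move=> a b r m j da db va /= /andP[wa wb] P off r0.
  rewrite code_at_cat => -[Ce [C1 _]] Hag.
  have [r1 [R1 v1 v2 A1]] := comp_pair_correct m wa wb da db Hag Ce.
  exists r1; split=> //.
  by rewrite size_cat (runD _ R1) /= C1 /= v1 va address_nat /= v2 addnA addn1.
- move=> c1 c2 r m t1 r1 m1 t2 r2 m2 _ IH1 _ IH2 /= /andP[w1 w2] P off r0.
  rewrite code_at_cat => -[C1 C2] Hag.
  have [q1 [Q1 A1]] := IH1 w1 P off r0 C1 Hag.
  have [q2 [Q2 A2]] := IH2 w2 P _ q1 C2 A1.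
  by exists q2; rewrite (runD _ Q1) size_cat addnA.
- move=> a b c1 c2 r m t r' m' da db le_ab _ IH /= /and4P[wa wb w1 w2] P off r0.
  rewrite code_at_cat /= => -[Ch [Cj]]; rewrite code_at_cat /= => -[C2 [Ce C1]] Hag.
  have [q [Q va vb Aq]] := comp_pair_correct m wa wb da db Hag Ch.
  have [q1 [Q1 A1]] := IH w1 P _ q C1 Aq.
  exists q1; split=> //.
  rewrite (runD _ Q) (@runD P 1 _ _ (State ((off + size (comp_pair a b)).+1 +
    size (compile (off + size (comp_pair a b)).+1 c2)).+1 q m)).
    by rewrite Q1 !size_cat /= !size_cat /=; congr (Some (State _ _ _)); lia.
  by apply: run1; rewrite /step Cj va vb le_ab.
- move=> a b c1 c2 r m t r' m' da db lt_ba _ IH /= /and4P[wa wb w1 w2] P off r0.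
  rewrite code_at_cat /= => -[Ch [Cj]]; rewrite code_at_cat /= => -[C2 [Ce C1]] Hag.
  have [q [Q va vb Aq]] := comp_pair_correct m wa wb da db Hag Ch.
  have [q1 [Q1 A1]] := IH w2 P _ q C2 Aq.
  exists q1; split=> //.
  rewrite (runD _ Q) (@runD P 1 _ _ (State (off + size (comp_pair a b)).+1 q m)).
    rewrite (runD _ Q1) /= Ce /= lexx !size_cat /= !size_cat /=.
    by congr (Some (State _ _ _)); lia.
  by apply: run1; rewrite /step Cj va vb leNgt lt_ba.
- move=> a b c r m t r1 m1 t' r' m' da db le_ab _ IH1 _ IH2 wc P off r0 HC Hag.
  move: (wc) (HC) => /= /and3P[wa wb w1].
  rewrite code_at_cat /= => -[Ch [Cj [Ce]]]; rewrite code_at_cat /= => -[C1 [Cb _]].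
  have [q [Q va vb Aq]] := comp_pair_correct m wa wb da db Hag Ch.
  have [q1 [Q1 A1]] := IH1 w1 P _ q C1 Aq.
  have [q2 [Q2 A2]] := IH2 wc P off q1 HC A1.
  exists q2; split=> //.
  rewrite (runD _ Q) (@runD P 1 _ _ (State (off + size (comp_pair a b)).+2 q m)).
    rewrite (runD _ Q1) (@runD P 1 _ _ (State off q1 m1)) ?Q2 //.
    by apply: run1; rewrite /step Cb lexx.
  by apply: run1; rewrite /step Cj va vb le_ab.
- move=> a b c r m da db lt_ba /= /and3P[wa wb w1] P off r0.
  rewrite code_at_cat /= => -[Ch [Cj [Ce _]]] Hag.
  have [q [Q va vb Aq]] := comp_pair_correct m wa wb da db Hag Ch.
  exists q; split=> //.
  rewrite (runD _ Q) /= Cj /= va vb leNgt lt_ba /= Ce /= lexx.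
  by rewrite !size_cat /= !size_cat /=; congr (Some (State _ _ _)); lia.
Qed.

Definition wp (c : cmd) r m (T : nat) (Q : (nat -> R) -> (nat -> R) -> Prop) :=
  exists t r' m', [/\ ev c r m t r' m', (t <= T)%N & Q r' m'].

(** Rule of consequence with the frame rule built in. In the proofs about programs it also postpones
    the accounting: the structural rules determine [T] by unification, and [T <= T'] is shelved
    until the end. *)
Lemma wp_weaken c r m T T' (Q Q' : _ -> _ -> Prop) :
  wp c r m T Q -> (T <= T')%N ->
  (forall r' m', (forall i, i \notin writes c -> r' i = r i) ->
     (storeless c -> m' = m) -> Q r' m' -> Q' r' m') ->
  wp c r m T' Q'.
Proof.
move=> [t [r' [m' [He Ht HQ]]]] HT HQQ; exists t, r', m'; split=> //.
  exact: leq_trans HT.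
by have [F1 F2] := ev_frame He; apply: HQQ.
Qed.

Lemma wp_set v e r m (Q : _ -> _ -> Prop) : edef e r ->
  Q (upd r v (denote e r)) m -> wp (CSet v e) r m (size (comp_expr e tmp) + 2) Q.
Proof. by move=> de HQ; do 3!eexists; split; [exact: EvSet| |]. Qed.

Lemma wp_load v e r m j (Q : _ -> _ -> Prop) : edef e r -> denote e r = j%:R ->
  Q (upd r v (m j)) m -> wp (CLoad v e) r m (size (comp_expr e tmp) + 1) Q.
Proof. by move=> de He HQ; do 3!eexists; split; [exact: EvLoad He| |]. Qed.

Lemma wp_store a b r m j (Q : _ -> _ -> Prop) : edef a r -> edef b r ->
  denote a r = j%:R -> Q r (upd m j (denote b r)) ->
  wp (CStore a b) r m (pair_cost a b + 1) Q.
Proof. by move=> da db He HQ; do 3!eexists; split; [exact: EvStore He| |]. Qed.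

Lemma wp_seq c1 c2 r m T1 T2 Q :
  wp c1 r m T1 (fun r1 m1 => wp c2 r1 m1 T2 Q) -> wp (CSeq c1 c2) r m (T1 + T2) Q.
Proof.
move=> [t1 [r1 [m1 [E1 H1 [t2 [r2 [m2 [E2 H2 HQ]]]]]]]].
by exists (t1 + t2)%N, r2, m2; split; [exact: EvSeq E1 E2|exact: leq_add|].
Qed.

Lemma wp_if a b c1 c2 r m T Q : edef a r -> edef b r ->
  (if denote a r <= denote b r then wp c1 r m T Q else wp c2 r m T Q) ->
  wp (CIf a b c1 c2) r m (pair_cost a b + (T + 2)) Q.
Proof.
move=> da db; case: ifP => [le_ab|/negbT]; last rewrite -ltNge => lt_ba.
  move=> [t [r' [m' [E Ht HQ]]]].
  exists (pair_cost a b + (1 + t))%N, r', m'; split=> //; last by lia.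
  exact: EvIfT.
move=> [t [r' [m' [E Ht HQ]]]].
exists (pair_cost a b + (1 + (t + 1)))%N, r', m'; split=> //; last by lia.
exact: EvIfF.
Qed.

(** The index of the invariant is fuel: a true guard forces it to be a successor and the body lowers
    it by one, so at most [f] rounds take place. The loop may stop with fuel left. The frame facts
    refer to the state before the loop, so invariants need not mention untouched registers. *)
Lemma wp_while (Inv : nat -> (nat -> R) -> (nat -> R) -> Prop) a b c r m f T :
  (forall f r1 m1, (forall i, i \notin writes c -> r1 i = r i) ->
     (storeless c -> m1 = m) -> Inv f r1 m1 ->
     [/\ edef a r1, edef b r1 & denote a r1 <= denote b r1 ->
       exists2 f', f = f'.+1 & wp c r1 m1 T (Inv f')]) ->
  Inv f r m ->
  wp (CWhile a b c) r m (f * (pair_cost a b + T + 2) + (pair_cost a b + 2))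
    (fun r' m' => (exists f', Inv f' r' m') /\ denote b r' < denote a r').
Proof.
move=> Hstep.
suff H f1 r1 m1 : (forall i, i \notin writes c -> r1 i = r i) ->
    (storeless c -> m1 = m) -> Inv f1 r1 m1 ->
    wp (CWhile a b c) r1 m1 (f1 * (pair_cost a b + T + 2) + (pair_cost a b + 2))
    (fun r' m' => (exists f', Inv f' r' m') /\ denote b r' < denote a r') by exact: H.
elim: f1 r1 m1 => [|f1 IH] r1 m1 Fr Fm HI;
  have [da db Hs] := Hstep _ _ _ Fr Fm HI.
  have lt_ba : denote b r1 < denote a r1 by rewrite ltNge; apply/negP => /Hs[].
  exists (pair_cost a b + 2)%N, r1, m1; split=> //; first exact: EvWhileF.
  by split=> //; exists 0%N.
have [le_ab|lt_ba] := leP (denote a r1) (denote b r1).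
  have [_ [<-] [t [r2 [m2 [E2 H2 HI2]]]]] := Hs le_ab.
  have [F1 F2] := ev_frame E2.
  have Fr2 i : i \notin writes c -> r2 i = r i by move=> Hi; rewrite F1 ?Fr.
  have Fm2 : storeless c -> m2 = m by move=> Hc; rewrite F2 ?Fm.
  have [t3 [r3 [m3 [E3 H3 HI3]]]] := IH _ _ Fr2 Fm2 HI2.
  exists (pair_cost a b + (1 + (t + (1 + t3))))%N, r3, m3; split=> //.
    exact: EvWhileT E2 E3.
  by rewrite mulSn; lia.
exists (pair_cost a b + 2)%N, r1, m1; split=> //; first exact: EvWhileF.
  by rewrite leq_addl.
by split=> //; exists f1.+1.
Qed.

End Semantics.

(** * The generating function *)

Section Exponents.
Variables k l : nat -> nat.
Implicit Types p q : int * int.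

(** A pair [p] stands for (d, e), the exponents of x and y. Here item [j] joins X; in [addY] it
    joins Y. *)
Definition addX p j : int * int := (p.1 + (l j)%:Z, p.2 - (k j)%:Z).
Definition addY p j : int * int := (p.1 - (k j)%:Z, p.2 + (l j)%:Z).

(** One entry for each of the 3^m ways to distribute the items below [m] over X, Y and neither,
    starting from the contribution [p] of the items already placed. Repetitions are the coefficients
    of the generating function. *)
Fixpoint exponents (m : nat) p : seq (int * int) :=
  if m is m'.+1 then
    exponents m' p ++ exponents m' (addX p m') ++ exponents m' (addY p m')
  else [:: p].

Definition feasible m p : bool :=
  has (fun q : int * int => (0 <= q.1) && (0 <= q.2)) (exponents m p).

(** Item [m] is left out, joins X, or joins Y. This self-reduction is what the extraction of a pair
    follows. *)
Lemma feasibleS m p : feasible m.+1 p =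
  [|| feasible m p, feasible m (addX p m) | feasible m (addY p m)].
Proof. by rewrite /feasible /= !has_cat. Qed.

Lemma size_exponents m p : size (exponents m p) = (3 ^ m)%N.
Proof. by elim: m p => //= m IH p; rewrite !size_cat !IH expnS; lia. Qed.

(** Each item changes the exponent of y by at most [B]. The resulting bound is what N, and thereby x
    = y^(2N+2), is chosen from. *)
Lemma exponents_bound (B : nat) m p :
  (forall j, (j < m)%N -> (k j <= B)%N && (l j <= B)%N) ->
  {in exponents m p, forall q : int * int, (`|q.2| <= `|p.2| + m * B)%N}.
Proof.
elim: m p => [|m IH] p HB q /=; first by rewrite inE => /eqP->; lia.
have HB' j : (j < m)%N -> (k j <= B)%N && (l j <= B)%N.
  by move=> Hj; apply: HB; lia.
have /andP[Hk Hl] := HB m (ltnSn m).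
by rewrite !mem_cat => /or3P[] /(IH _ HB') /=; rewrite mulSn; lia.
Qed.

Lemma mem_exponents (fX fY : nat -> bool) m p :
  (forall j, (j < m)%N -> ~~ (fX j && fY j)) ->
  (p.1 + (\sum_(j < m) fX j * l j)%:Z - (\sum_(j < m) fY j * k j)%:Z,
   p.2 + (\sum_(j < m) fY j * l j)%:Z - (\sum_(j < m) fX j * k j)%:Z)
    \in exponents m p.
Proof.
elim: m p => [|m IH] p Hd /=.
  rewrite !big_ord0 inE; apply/eqP; case: p => p1 p2 /=; congr (_, _); lia.
have Hd' j : (j < m)%N -> ~~ (fX j && fY j) by move=> Hj; apply: Hd; lia.
have := Hd m (ltnSn m); rewrite !big_ord_recr /= !mem_cat.
set sXl := (\sum_(j < m) fX j * l j)%N; set sYk := (\sum_(j < m) fY j * k j)%N.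
set sYl := (\sum_(j < m) fY j * l j)%N; set sXk := (\sum_(j < m) fX j * k j)%N.
case: (fX m) (fY m) => -[] //= _; apply/or3P.
- constructor 2; rewrite (_ : (_, _) = ((addX p m).1 + sXl%:Z - sYk%:Z,
    (addX p m).2 + sYl%:Z - sXk%:Z)) ?IH //=; congr (_, _); lia.
- constructor 3; rewrite (_ : (_, _) = ((addY p m).1 + sXl%:Z - sYk%:Z,
    (addY p m).2 + sYl%:Z - sXk%:Z)) ?IH //=; congr (_, _); lia.
- by constructor 1; rewrite !mul0n !addn0; apply: IH.
Qed.

Section Monomials.
Variables (R : realType) (x y : R).
Hypotheses (x0 : x != 0) (y0 : y != 0).

Definition monomial p : R := x ^ p.1 * y ^ p.2.

Lemma monomialX p j : monomial (addX p j) = monomial p * (x ^+ l j / y ^+ k j).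
Proof. by rewrite /monomial /= !expfzDr // -!exprnN -!exprnP; ring. Qed.

Lemma monomialY p j : monomial (addY p j) = monomial p * (y ^+ l j / x ^+ k j).
Proof. by rewrite /monomial /= !expfzDr // -!exprnN -!exprnP; ring. Qed.

Lemma prod_monomial m p :
  monomial p * \prod_(j < m) (1 + x ^+ l j / y ^+ k j + y ^+ l j / x ^+ k j)
    = \sum_(q <- exponents m p) monomial q.
Proof.
elim: m p => [|m IH] p /=; first by rewrite big_ord0 big_seq1 mulr1.
rewrite !big_cat /= -!IH big_ord_recr /= monomialX monomialY; ring.
Qed.

End Monomials.
End Exponents.

Lemma floor_int_add (R : realType) (z h : R) :
  z \is a Num.int -> 0 <= h < 1 -> (Num.floor (z + h))%:~R = z.
Proof.
move=> /intrP[i ->] /andP[h0 h1]; congr _%:~R; apply/floor_def.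
by rewrite intrD lerDl h0 ltrD2l.
Qed.

Lemma sum_le_size (R : realDomainType) (I : eqType) (s : seq I) (P : pred I)
    (F : I -> R) (c : R) :
  0 <= c -> {in s, forall i, P i -> F i <= c} ->
  \sum_(i <- s | P i) F i <= (size s)%:R * c.
Proof.
move=> c0; elim: s => [|i s IH] HF /=; first by rewrite big_nil mul0r.
rewrite big_cons -natr1 mulrDl mul1r [leRHS]addrC.
have Hs : \sum_(j <- s | P j) F j <= (size s)%:R * c.
  by apply: IH => j Hj; apply: HF; rewrite inE Hj orbT.
case: ifP => Pi; first by rewrite lerD // HF // mem_head.
by rewrite (le_trans Hs) // lerDr.
Qed.

Lemma ltz0_leN1 (z : int) : z < 0 -> z <= -1.
Proof. lia. Qed.

Lemma absz_addr_ge (z : int) (N : nat) : 0 <= z -> (N <= absz (z + N%:Z)%R)%N.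
Proof. lia. Qed.

(** * Detecting a monomial with nonnegative exponents by arithmetic *)

Section Test.
Variables (R : realType) (N Y : nat) (s : seq (int * int)).
Let y : R := Y%:R.
Let x : R := y * y * y ^+ N * y ^+ N.
Hypothesis Y_gt1 : (1 < Y)%N.
Hypothesis sY : (size s < Y)%N.
Hypothesis sN : {in s, forall q : int * int, (`|q.2| <= N)%N}.
Let G : R := \sum_(q <- s) monomial x y q.
Let G1 : R := (Num.floor (G * y ^+ N))%:~R.

(* Since [x] exceeds every power of [y] that occurs, the first floor deletes
   the monomials with a negative exponent of [x], and reduction modulo [x - 1]
   substitutes 1 for [x] in the remaining ones. *)
Lemma feasible_test :
  (y ^+ N <= G1 - (x - 1) * (Num.floor (G1 / (x - 1)))%:~R)
    = has (fun q : int * int => (0 <= q.1) && (0 <= q.2)) s.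
Proof.
have Y2 : 2 <= y by rewrite (ler_nat _ 2).
have y0 : 0 < y by lra.
have yN : 1 <= y ^+ N by rewrite exprn_ege1 //; lra.
have yN0 : 0 < y ^+ N by lra.
pose w := y ^+ N * y ^+ N.
have w1 : 1 <= w by rewrite -[leLHS]mulr1 ler_pM.
have yw : 2 <= y * w by rewrite -[leLHS]mulr1 ler_pM.
have yY : (size s)%:R <= y - 1 by rewrite lerBrDr natr1 ler_nat.
(* There are fewer than y monomials, and after multiplication by y^N the power of y in each is at
   most w = y^(2N). Hence these powers sum to less than y w = x / y. *)
have sw : (size s)%:R * w <= y * w - w.
  by rewrite -[X in _ - X]mul1r -mulrBl ler_wpM2r //; lra.
have xE : x = y * (y * w) by rewrite /x /w; ring.
have x2 : 2 * (y * w) <= x by rewrite xE ler_wpM2r //; lra.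
have x1 : 1 < x by lra.
have x0 : 0 < x by lra.
pose e (q : int * int) := absz (q.2 + N%:Z).
have eE (q : int * int) : q \in s -> y ^ q.2 * y ^+ N = y ^+ e q.
  by move=> /sN Hq; rewrite (exprnP y N) -expfzDr ?gt_eqF // (exprnP y (e q)) /e gez0_abs //; lia.
have e2 (q : int * int) : q \in s -> y ^+ e q <= w.
  by move=> /sN Hq; rewrite /w -exprD ler_weXn2l ?(le_trans _ Y2) ?ler1n // /e; lia.
pose H : R := \sum_(q <- s | 0 <= q.1) y ^+ e q.
have H0 : 0 <= H by apply: sumr_ge0 => q _; rewrite exprn_ge0 ?ltW.
have Hle : H <= (size s)%:R * w.
  by apply: sum_le_size => [|q Hq _]; [lra|exact: e2].
have Hlt : H < x - 1 by lra.
(* For d >= 0, x^d = (x - 1)(1 + ... + x^(d-1)) + 1. So [Z] is the quotient modulo x - 1, and [H],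
   which is less than x - 1, is the remainder. *)
pose Z : R := \sum_(q <- s | 0 <= q.1) (\sum_(i < `|q.1|) x ^+ i) * y ^+ e q.
have xint : x \is a Num.int by rewrite /x !rpredM ?rpredX ?natr_int.
have Zint : Z \is a Num.int.
  apply: rpred_sum => q _; rewrite rpredM ?rpredX ?natr_int //.
  by apply: rpred_sum => i _; rewrite rpredX.
have Hint : H \is a Num.int.
  by apply: rpred_sum => q _; rewrite rpredX ?natr_int.
(* The terms with d < 0 are at most w / x each and less than 1 in total, so the first floor removes
   exactly them. *)
pose D : R := \sum_(q <- s | ~~ (0 <= q.1)) x ^ q.1 * y ^+ e q.
have GE : G * y ^+ N = (x - 1) * Z + H + D.
  rewrite /G mulr_suml (eq_big_seq (fun q => x ^ q.1 * y ^+ e q)); last first.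
    by move=> q Hq; rewrite /monomial -mulrA eE.
  rewrite (bigID (fun q : int * int => 0 <= q.1)) /=; congr (_ + _).
  rewrite mulr_sumr -big_split /=; apply: eq_bigr => q Hq.
  rewrite mulrA -subrX1 -{1}(gez0_abs Hq) -exprnP; ring.
have D0 : 0 <= D.
  by apply: sumr_ge0 => q _; rewrite mulr_ge0 ?exprz_ge0 ?exprn_ge0 // ltW.
have D1 : D < 1.
  have HD : D <= (size s)%:R * (x^-1 * w).
    apply: sum_le_size => [|q Hq Hn].
      by rewrite mulr_ge0 ?invr_ge0 ?(ltW x0) // (le_trans _ w1).
    apply: ler_pM; [exact/exprz_ge0/ltW|exact/exprn_ge0/ltW| |exact: e2].
    have q1 : q.1 <= -1 by move: Hn; rewrite -ltNge; exact: ltz0_leN1.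
    by rewrite -(exprN1 x); apply: ler_weXz2l q1; exact: ltW.
  apply: le_lt_trans HD _; rewrite mulrCA [ltLHS]mulrC ltr_pdivrMr // mul1r; lra.
have G1E : G1 = (x - 1) * Z + H.
  by rewrite /G1 GE floor_int_add ?D0 ?D1 // rpredD ?rpredM ?rpredB ?rpred1.
have x10 : 0 < x - 1 by lra.
have -> : G1 / (x - 1) = Z + H / (x - 1).
  by rewrite G1E mulrDl mulrAC divff ?mul1r ?gt_eqF.
rewrite floor_int_add //; last by rewrite divr_ge0 ?ltr_pdivrMr ?mul1r ?Hlt ?(ltW x10).
(* Without a good monomial, [H] has fewer than y terms, each at most y^(N-1), so it is below y^N. A
   single good monomial already contributes at least y^N. *)
rewrite G1E addrAC subrr add0r; apply/idP/hasP => [HN|[q Hq /andP[q1 q2]]].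
  apply/hasP; apply: contraT => /hasPn Hs; suff : H < y ^+ N by rewrite ltNge HN.
  have HH : H <= (size s)%:R * (y^-1 * y ^+ N).
    apply: sum_le_size => [|q Hq q1]; first by rewrite mulr_ge0 ?invr_ge0 ?ltW.
    have := Hs _ Hq; rewrite q1 /= -ltNge => q2.
    rewrite -eE // ler_pM2r // -(exprN1 y).
    have q2' : q.2 <= -1 by exact: ltz0_leN1.
    by apply: ler_weXz2l q2'; lra.
  apply: le_lt_trans HH _; rewrite mulrCA [ltLHS]mulrC ltr_pdivrMr // [ltRHS]mulrC ltr_pM2r //; lra.
rewrite /H (big_rem q) //= q1 -[leLHS]addr0 lerD //.
  rewrite ler_weXn2l ?(le_trans _ Y2) ?ler1n // /e.
  exact: absz_addr_ge.
by apply: sumr_ge0 => i _; rewrite exprn_ge0 ?ltW.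
Qed.
End Test.

(** * Rounding *)

Lemma big_ord_pred (T : Type) (idx : T) (op : Monoid.law idx) (F : nat -> T) n :
  (0 < n)%N ->
  \big[op/idx]_(j < n) F j = op (\big[op/idx]_(j < n.-1) F j) (F n.-1).
Proof. by case: n => // n _; rewrite big_ord_recr. Qed.

Section Rounding.
Variables (R : realType) (a : nat -> R) (K rho : R).

Definition rdown j : nat := Num.truncn (K * a j).
Definition rup j : nat := (Num.truncn (K * rho * a j)).+1.

Definition selsum (f : nat -> bool) n : R := \sum_(j < n) (f j)%:R * a j.

Lemma selsum_pred1 i n : (i < n)%N -> selsum (fun j => j == i) n = a i.
Proof.
move=> Hi; rewrite /selsum (bigD1 (Ordinal Hi)) //= eqxx mul1r big1 ?addr0 //.
by move=> j; rewrite -val_eqE /= => /negPf->; rewrite mul0r.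
Qed.

Hypotheses (K0 : 0 < K) (rho0 : 0 <= rho).

(** The smaller side is rounded down and the larger side up, so rounding can only help the
    inequality. *)
Lemma rounding_complete n (f g : nat -> bool) :
  (forall j, (j < n)%N -> 0 <= a j) ->
  selsum f n <= rho * selsum g n ->
  (\sum_(j < n) f j * rdown j <= \sum_(j < n) g j * rup j)%N.
Proof.
move=> a0 H; rewrite -(ler_nat R) !natr_sum.
apply: (@le_trans _ _ (K * selsum f n)).
  rewrite /selsum mulr_sumr ler_sum // => j _; rewrite natrM mulrCA.
  by rewrite ler_wpM2l // truncn_le mulr_ge0 ?a0 // ltW.
apply: (le_trans (ler_wpM2l (ltW K0) H)).
rewrite /selsum !mulr_sumr ler_sum // => j _; rewrite natrM.
have -> : K * (rho * ((g j)%:R * a j)) = (g j)%:R * (K * rho * a j) by ring.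
by rewrite ler_wpM2l // ltW // truncnS_gt.
Qed.

(** By disjointness every item occurs on at most one side, where its rounding error is at most 1;
    this gives n in total. *)
Lemma rounding_sound n (f g : nat -> bool) :
  (forall j, (j < n)%N -> 0 <= a j) ->
  (forall j, (j < n)%N -> ~~ (f j && g j)) ->
  (\sum_(j < n) f j * rdown j <= \sum_(j < n) g j * rup j)%N ->
  K * selsum f n <= K * (rho * selsum g n) + n%:R.
Proof.
move=> a0 Hd; rewrite -(ler_nat R) !natr_sum => H.
(* Writing n as a sum of ones reduces the claim to a comparison item by item. *)
rewrite -[n in n%:R]card_ord -sum1_card natr_sum /selsum !mulr_sumr.
rewrite -big_split /= -subr_ge0 -sumrB.
move: H; rewrite -subr_ge0 -sumrB => /le_trans; apply; apply: ler_sum => j _.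
have aj := a0 j (ltn_ord j).
have Ka : 0 <= K * a j by rewrite mulr_ge0 // ltW.
have Kra : 0 <= K * rho * a j by rewrite !mulr_ge0 // ltW.
have h1 : K * a j <= (rdown j)%:R + 1.
  by rewrite natr1 ltW // truncnS_gt.
have h2 : (rup j)%:R <= K * rho * a j + 1.
  by rewrite /rup -natr1 lerD2r truncn_le.
have := Hd j (ltn_ord j); rewrite !natrM.
case: (f j) (g j) => -[] //= _; rewrite ?mul0r ?mul1r ?mulr0; lra.
Qed.

End Rounding.

(** * Subsets as selections of sorted items, and bounds on the optimum *)

Section Selections.
Variables (R : realType) (J : {fset R}).
Local Notation n := #|` J|.
Local Notation a := (nth 0 (items J)).

Definition select (f : nat -> bool) : {fset R} :=
  [fset x in J | f (index x (items J))]%fset.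

Lemma size_items : size (items J) = n.
Proof. by rewrite size_sort. Qed.

Lemma mem_items x : (x \in items J) = (x \in J).
Proof. by rewrite mem_sort. Qed.

Lemma uniq_items : uniq (items J).
Proof. by rewrite sort_uniq fset_uniq. Qed.

Lemma nth_items j : (j < n)%N -> a j \in J.
Proof. by move=> Hj; rewrite -mem_items mem_nth // size_items. Qed.

Lemma index_items j : (j < n)%N -> index (a j) (items J) = j.
Proof. by move=> Hj; rewrite index_uniq ?size_items ?uniq_items. Qed.

Lemma le_items i j : (i <= j)%N -> (j < n)%N -> a i <= a j.
Proof.
move=> ij jn; apply: le_sorted_leq_nth; rewrite ?inE ?size_items //.
- exact: sort_le_sorted.
- exact: leq_ltn_trans jn.
Qed.

Lemma Sigma_select f : Sigma (select f) = selsum a f n.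
Proof.
rewrite /Sigma /select big_fset /= (perm_big (items J)) /=; last first.
  by rewrite perm_sym perm_sort.
rewrite (big_nth 0) size_items big_mkord big_mkcond /=.
apply: eq_bigr => j _; rewrite index_items //.
by case: (f j); rewrite ?mul1r ?mul0r.
Qed.

Lemma select_mem X : (X `<=` J)%fset -> X = select (fun j => a j \in X).
Proof.
move=> /fsubsetP XJ; apply/fsetP => x; rewrite !inE /=.
apply/idP/andP => [Hx|[Hx]]; last by rewrite nth_index ?mem_items.
by rewrite nth_index ?mem_items ?Hx ?XJ.
Qed.

Lemma select_sub f : (select f `<=` J)%fset.
Proof. by apply/fsubsetP => x; rewrite !inE /= => /andP[]. Qed.

Lemma select_disjoint f g : (forall j, (j < n)%N -> ~~ (f j && g j)) ->
  [disjoint select f & select g]%fset.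
Proof.
move=> H; apply/fdisjointP => x; rewrite !inE /= => /andP[xJ fx].
have := H (index x (items J)).
by rewrite -size_items index_mem mem_items xJ fx /= => ->.
Qed.

Hypothesis J0 : forall x, x \in J -> 0 < x.
Hypothesis n0 : (0 < n)%N.

Lemma item_gt0 j : (j < n)%N -> 0 < a j.
Proof. by move=> /nth_items /J0. Qed.

Lemma fset_maxE : fset_max J = a n.-1.
Proof.
have ln : (n.-1 < n)%N by rewrite prednK.
apply/le_anti/andP; split.
  rewrite /fset_max big_seq; apply: bigmax_le => [|x xJ].
    exact/ltW/item_gt0.
  rewrite -(nth_index 0 (_ : x \in items J)) ?mem_items //.
  have : (index x (items J) < n)%N by rewrite -size_items index_mem mem_items.
  by move=> H; apply: le_items => //; rewrite -ltnS prednK.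
exact: (le_bigmax_seq 0 _ xpredT id (nth_items ln) isT).
Qed.

Lemma selsum_ge0 f m : (m <= n)%N -> 0 <= selsum a f m.
Proof.
move=> mn; apply: sumr_ge0 => j _; rewrite mulr_ge0 ?ler0n // ltW // item_gt0 //.
exact: leq_trans mn.
Qed.

Lemma Sigma_ge0 X : (X `<=` J)%fset -> 0 <= Sigma X.
Proof. by move=> /select_mem->; rewrite Sigma_select selsum_ge0. Qed.

Lemma sum_ratioC (X Y : {fset R}) : sum_ratio X Y = sum_ratio Y X.
Proof. by rewrite /sum_ratio maxC. Qed.

(** The ratio is symmetric, so the maximum may be assumed to lie in X. *)
Lemma OPT_L_ge v :
  (forall X Y, (X `<=` J)%fset -> (Y `<=` J)%fset -> [disjoint X & Y]%fset ->
     a n.-1 \in X -> (v%:E <= sum_ratio X Y)%E) ->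
  (v%:E <= OPT_L J)%E.
Proof.
move=> H; rewrite /OPT_L big_seq; apply: le_bigmin => [|X]; first exact: leey.
rewrite fpowersetE => XJ.
rewrite big_seq_cond; apply: le_bigmin => [|Y]; first exact: leey.
rewrite fpowersetE fset_maxE inE => /and3P[YJ dXY /orP[]] Hm; first exact: H.
by rewrite sum_ratioC; apply: H => //; rewrite fdisjoint_sym.
Qed.

(** One of two mutually inverse quotients is at least 1, and an empty side gives +oo. *)
Lemma OPT_L_ge1 : (1%:E <= OPT_L J)%E.
Proof.
apply: OPT_L_ge => X Y XJ YJ _ _; rewrite /sum_ratio /ratio_div le_max.
have X0 := Sigma_ge0 XJ; have Y0 := Sigma_ge0 YJ.
case: eqP => [_|/eqP Yn]; first by rewrite leey.
case: eqP => [_|/eqP Xn]; first by rewrite leey orbT.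
by rewrite !lee_fin !ler_pdivlMr ?lt_def ?Xn ?Yn // !mul1r le_total.
Qed.

Lemma sum_ratio_ltE rho (X Y : {fset R}) : 0 <= Sigma X -> 0 <= Sigma Y ->
  (sum_ratio X Y < rho%:E)%E ->
  Sigma X <= rho * Sigma Y /\ Sigma Y <= rho * Sigma X.
Proof.
rewrite /sum_ratio /ratio_div => X0 Y0; rewrite gt_max => /andP[].
case: eqP => [|/eqP Y1]; first by [].
case: eqP => [|/eqP X1]; first by [].
rewrite !lte_fin => H1 H2; split.
  by rewrite -ler_pdivrMr ?lt_def ?Y1 // ltW.
by rewrite -ler_pdivrMr ?lt_def ?X1 // ltW.
Qed.

Lemma sum_ratio_leE c (X Y : {fset R}) : 0 < Sigma X -> 0 < Sigma Y ->
  Sigma X <= c * Sigma Y -> Sigma Y <= c * Sigma X -> (sum_ratio X Y <= c%:E)%E.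
Proof.
move=> X0 Y0 H1 H2; rewrite /sum_ratio /ratio_div !gt_eqF // ge_max !lee_fin.
by rewrite !ler_pdivrMr // H1.
Qed.

(** The optimum itself is never known; a pair is compared with a certified lower bound [v]. Both
    sums must be positive, since otherwise the ratio is +oo. *)
Lemma SSR_L_solution_select eps v f g : 0 < eps ->
  (forall j, (j < n)%N -> ~~ (f j && g j)) ->
  (v%:E <= OPT_L J)%E -> 0 < selsum a f n -> 0 < selsum a g n ->
  selsum a f n <= (1 + eps) * v * selsum a g n ->
  selsum a g n <= (1 + eps) * v * selsum a f n ->
  SSR_L_solution J eps (select f) (select g).
Proof.
move=> e0 Hd Hv f0 g0 H1 H2; split; rewrite ?select_sub ?select_disjoint //.
apply: (@le_trans _ _ ((1 + eps) * v)%:E).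
  by apply: sum_ratio_leE; rewrite !Sigma_select.
by rewrite EFinM lee_pmul2l // lte_fin; lra.
Qed.

Section Main.
Variables (K rho : R).
Hypothesis K0 : 0 < K.
Local Notation k := (rdown a K).
Local Notation l := (rup a K rho).

(** The exponents when only the maximum has been placed, namely into X. *)
Definition start : int * int := ((l n.-1)%:Z, - (k n.-1)%:Z).

(** [rounding_complete] applied in both directions gives e >= 0 and d >= 0. The maximum is split off
    both sums because [start] accounts for it. *)
Lemma feasible_of_ratio (f g : nat -> bool) :
  (forall j, (j < n)%N -> ~~ (f j && g j)) -> f n.-1 ->
  selsum a f n <= rho * selsum a g n -> selsum a g n <= rho * selsum a f n ->
  feasible k l n.-1 start.
Proof.
move=> Hd fn.
have a0 j : (j < n)%N -> 0 <= a j by move=> /item_gt0/ltW.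
move=> /(rounding_complete K0 a0) H1 /(rounding_complete K0 a0) H2.
have gn : g n.-1 = false.
  by have := Hd n.-1; rewrite fn prednK // leqnn /= => /(_ isT)/negPf.
apply/hasP; eexists.
  apply: (@mem_exponents _ _ f g) => j Hj; apply: Hd.
  by rewrite -(prednK n0) ltnW.
have E (h : nat -> nat) := big_ord_pred addn h n0.
move: H1 H2; rewrite (E (fun j => f j * k j)%N) (E (fun j => g j * l j)%N).
rewrite (E (fun j => g j * k j)%N) (E (fun j => f j * l j)%N) /= fn gn !mul0n !mul1n.
rewrite !addn0 /start /=; clear; lia.
Qed.

(** A pair of ratio below [rho] would satisfy the two unrounded inequalities and hence pass the
    test. *)
Lemma infeasible_lower_bound : ~~ feasible k l n.-1 start ->
  (rho%:E <= OPT_L J)%E.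
Proof.
move=> Hn; apply: OPT_L_ge => X Y XJ YJ dXY Xn.
rewrite leNgt; apply/negP => /(sum_ratio_ltE (Sigma_ge0 XJ) (Sigma_ge0 YJ)).
have SX : Sigma X = selsum a (fun j => a j \in X) n.
  by rewrite {1}(select_mem XJ) Sigma_select.
have SY : Sigma Y = selsum a (fun j => a j \in Y) n.
  by rewrite {1}(select_mem YJ) Sigma_select.
rewrite SX SY => -[H1 H2]; case/negP: Hn.
apply: feasible_of_ratio H1 H2 => // j _.
apply/andP => -[jX jY]; move/fdisjointP: dXY => /(_ _ jX).
by rewrite jY.
Qed.

End Main.

(** With S and T the two sums, rounding costs at most eps/4 times the maximum, which is at most
    (eps/4) S. So (1 - eps/4) S <= rho T and T <= (rho + eps/4) S, and lo >= 1 and eps < 1 yield lo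
    + eps/4 <= (1 - eps/4)(1 + eps) lo. *)
Lemma rounded_solution eps lo rho f g : 0 < eps < 1 ->
  let K := 4 * n%:R / (eps * a n.-1) in
  (forall j, (j < n)%N -> ~~ (f j && g j)) -> f n.-1 ->
  (lo%:E <= OPT_L J)%E -> 1 <= lo -> 0 <= rho -> rho <= lo + eps / 4 ->
  (\sum_(j < n) f j * rdown a K j <= \sum_(j < n) g j * rup a K rho j)%N ->
  (\sum_(j < n) g j * rdown a K j <= \sum_(j < n) f j * rup a K rho j)%N ->
  SSR_L_solution J eps (select f) (select g).
Proof.
move=> /andP[e0 e1] K Hd fn Hlo lo1 rho0 Hrho.
have M0 : 0 < a n.-1 by rewrite item_gt0 // prednK.
have nn0 : 0 < n%:R :> R by rewrite ltr0n.
have K0 : 0 < K by rewrite /K divr_gt0 ?mulr_gt0.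
have a0 j : (j < n)%N -> 0 <= a j by move=> /item_gt0/ltW.
have Hd' j : (j < n)%N -> ~~ (g j && f j) by rewrite andbC; apply: Hd.
move=> /(rounding_sound K0 rho0 a0 Hd) H1 /(rounding_sound K0 rho0 a0 Hd') H2.
(* The choice of [K]: the total error n becomes eps/4 times the maximum after scaling back. *)
have nE : n%:R = K * (eps / 4 * a n.-1).
  by rewrite /K; field; rewrite !gt_eqF.
rewrite nE -mulrDr ler_pM2l // in H1; rewrite nE -mulrDr ler_pM2l // in H2.
have SM : a n.-1 <= selsum a f n.
  rewrite /selsum (big_ord_pred _ (fun j => (f j)%:R * a j) n0) /= fn mul1r lerDr.
  by apply: selsum_ge0; rewrite leq_pred.
set S := selsum a f n in H1 H2 SM; set T := selsum a g n in H1 H2.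
have T0 : 0 <= T by apply: selsum_ge0.
have S0 : 0 < S by lra.
have eM : eps / 4 * a n.-1 <= eps / 4 * S by rewrite ler_pM2l //; lra.
have S1 : S * (1 - eps / 4) <= rho * T by lra.
(* T = 0 would make S (1 - eps/4) nonpositive. *)
have Tp : 0 < T.
  rewrite lt_def T0 andbT; apply/eqP => TE.
  by move: S1; rewrite TE mulr0 leNgt mulr_gt0 //; lra.
have elo : eps <= eps * lo by rewrite ler_peMr // ltW.
apply: (SSR_L_solution_select e0 Hd Hlo) => //; rewrite -/S -/T.
  have e4 : 0 < 1 - eps / 4 by lra.
  rewrite -(ler_pM2r e4); apply: (le_trans S1).
  rewrite [leRHS]mulrAC ler_wpM2r //; apply: (le_trans Hrho).
  have ee : eps * (eps * lo) <= eps * lo by rewrite ler_piMl ?mulr_ge0 //; lra.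
  lra.
have h : rho * S + eps / 4 * S <= (1 + eps) * lo * S.
  by rewrite -mulrDl ler_wpM2r ?(ltW S0) //; lra.
lra.
Qed.

(** The other items sum to at most the maximum M, so this pair has ratio M divided by that sum. A
    competitor with M in X has at least M in X and at most that sum in Y, so it cannot be better. *)
Lemma dominant_solution eps f g : 0 < eps -> (1 < n)%N ->
  n%:R * a n.-2 <= a n.-1 ->
  (forall j, (j < n)%N -> f j = (j == n.-1)) ->
  (forall j, (j < n)%N -> g j = (j != n.-1)) ->
  SSR_L_solution J eps (select f) (select g).
Proof.
move=> e0 n1 Hdom Hf Hg.
have M0 : 0 < a n.-1 by rewrite item_gt0 // prednK.
have ln : (n.-1 < n)%N by rewrite prednK.
have nE : n.-1 = n.-2.+1 by case: (n) n1 => [|[]].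
have ln2 : (n.-2 < n)%N by rewrite (leq_trans _ ln) // nE.
have Hd j : (j < n)%N -> ~~ (f j && g j) by move=> Hj; rewrite Hf // Hg //; case: eqP.
have sumE h : selsum a h n = selsum a h n.-1 + (h n.-1)%:R * a n.-1.
  exact: (big_ord_pred _ (fun j => (h j)%:R * a j)).
have fE : selsum a f n = a n.-1.
  rewrite sumE Hf // eqxx mul1r /selsum big1 ?add0r // => j _.
  by rewrite Hf ?(ltn_trans (ltn_ord j)) // ltn_eqF // mul0r.
have gE : selsum a g n = selsum a (fun=> true) n.-1.
  rewrite sumE Hg // eqxx mul0r addr0; apply: eq_bigr => j _.
  by rewrite Hg ?(ltn_trans (ltn_ord j)) // ltn_eqF.
have gle : selsum a g n <= a n.-1.
  rewrite gE; apply: le_trans Hdom.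
  have -> : n%:R * a n.-2 = \sum_(j < n) a n.-2.
    by rewrite sumr_const card_ord mulr_natl.
  rewrite (big_ord_pred _ (fun=> a n.-2) n0) /= -[leLHS]addr0 lerD //.
    apply: ler_sum => j _; rewrite mul1r; apply: le_items ln2.
    by rewrite -ltnS -nE.
  exact/ltW/item_gt0.
have g0 : 0 < selsum a g n.
  rewrite gE /selsum nE big_ord_recr /= mul1r ltr_wpDl ?item_gt0 //.
  exact: (selsum_ge0 (fun=> true) (ltnW ln2)).
have MT : a n.-1 = a n.-1 / selsum a g n * selsum a g n.
  by rewrite divfK ?gt_eqF.
have v1 : 1 <= a n.-1 / selsum a g n by rewrite ler_pdivlMr // mul1r.
have ve : 1 <= (1 + eps) * (a n.-1 / selsum a g n).
  by rewrite -[leLHS]mulr1 ler_pM //; lra.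
apply: (SSR_L_solution_select (v := a n.-1 / selsum a g n) e0 Hd) => //.
- apply: OPT_L_ge => X Y XJ YJ dXY Xn; rewrite /sum_ratio le_max; apply/orP; left.
  have SX : a n.-1 <= Sigma X.
    rewrite {1}(select_mem XJ) Sigma_select sumE Xn mul1r lerDr.
    by apply: selsum_ge0; rewrite leq_pred.
  have SY : Sigma Y <= selsum a g n.
    have Yn : a n.-1 \in Y = false by apply/negbTE; move/fdisjointP: dXY; apply.
    rewrite {1}(select_mem YJ) Sigma_select sumE Yn mul0r addr0 gE.
    apply: ler_sum => j _; rewrite ler_wpM2r ?ler_nat ?leq_b1 //.
    by apply/ltW/item_gt0/(ltn_trans (ltn_ord j)).
  rewrite /ratio_div; case: eqP => [_|/eqP Y0]; first exact: leey.
  have Yp : 0 < Sigma Y by rewrite lt_def Y0 Sigma_ge0.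
  rewrite lee_fin; apply: ler_pM => //; rewrite ?invr_ge0 ?(ltW M0) ?(ltW g0) //.
  by rewrite lef_pV2.
- by rewrite fE.
- by rewrite fE -(mulrA (1 + eps)) -MT ler_peMl ?(ltW M0) //; lra.
- by rewrite fE (le_trans gle) // ler_peMl // ltW.
Qed.

End Selections.

(** * The program *)

Declare Scope expr_scope.
Delimit Scope expr_scope with X.
Bind Scope expr_scope with expr.
Local Notation "# i" := (EReg i) (at level 0, i at level 0, format "# i") : expr_scope.
Local Notation "$ z" := (EInt z%Z) (at level 0, z at level 0, format "$ z") : expr_scope.
Local Notation "a + b" := (EBin OpAdd a b) : expr_scope.
Local Notation "a - b" := (EBin OpSub a b) : expr_scope.
Local Notation "a * b" := (EBin OpMul a b) : expr_scope.
Local Notation "a / b" := (EBin OpDiv a b) : expr_scope.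
Local Notation "c1 ;; c2" := (CSeq c1 c2) (at level 90, right associativity).
Local Notation "v <- e" := (CSet v e%X) (at level 80).

Local Notation vn := 0%N (only parsing).
Local Notation veps := 1%N (only parsing).
Local Notation vmax := 2%N (only parsing).
Local Notation vi := 3%N (only parsing).
Local Notation vj := 4%N (only parsing).
Local Notation va := 5%N (only parsing).
Local Notation vK := 6%N (only parsing).
Local Notation vrho := 7%N (only parsing).
Local Notation vy := 8%N (only parsing).
Local Notation vyN := 9%N (only parsing).
Local Notation vx := 10%N (only parsing).
Local Notation vF := 11%N (only parsing).
Local Notation vG := 12%N (only parsing).
Local Notation vb := 13%N (only parsing).
Local Notation ve := 14%N (only parsing).
Local Notation vacc := 15%N (only parsing).
Local Notation vh := 16%N (only parsing).
Local Notation vk := 17%N (only parsing).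
Local Notation vl := 18%N (only parsing).
Local Notation vp := 19%N (only parsing).
Local Notation vq := 20%N (only parsing).
Local Notation vu := 21%N (only parsing).
Local Notation vv := 22%N (only parsing).
Local Notation vA := 23%N (only parsing).
Local Notation vB := 24%N (only parsing).
Local Notation vlo := 25%N (only parsing).
Local Notation vhi := 26%N (only parsing).
Local Notation vC := 27%N (only parsing).
Local Notation vS := 28%N (only parsing).
Local Notation vN := 29%N (only parsing).

(* The accumulator is multiplied by the base iff the exponent is odd. *)
Definition pow_body :=
  vh <- EFloor (#ve / $2) ;;
  vacc <- #vacc * ($1 + (#ve - $2 * #vh) * (#vb - $1)) ;;
  vb <- #vb * #vb ;;
  ve <- #vh.

Definition cpow d b e :=
  vb <- b ;; ve <- e ;; vacc <- $1 ;;
  CWhile $1 #ve pow_body ;;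
  d <- #vacc.

(** * Repeated squaring *)

Section PowSpec.
Variable R : realType.
Implicit Types (r m : nat -> R).

Lemma floor_half (k : nat) : Num.floor (k%:R / 2 : R) = (k./2)%:Z.
Proof.
apply/floor_def; rewrite -[k in k%:R]odd_double_half -muln2 natrD natrM.
rewrite intrD /= -!pmulrn; case: (odd k) => /=; apply/andP; split; lra.
Qed.

(** The quantity acc * b^k is invariant, and halving the exponent uses up one unit of fuel, as k <
    2^f. *)
Lemma wp_pow_body r m k f V : r ve = k%:R -> (k < 2 ^ f)%N ->
  r vacc * r vb ^+ k = V -> 1 <= r ve ->
  exists2 f', f = f'.+1 & wp pow_body r m 40 (fun r' _ =>
    exists k', [/\ r' ve = k'%:R, (k' < 2 ^ f')%N & r' vacc * r' vb ^+ k' = V]).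
Proof.
move=> He Hk HV H1.
have k1 : (0 < k)%N by rewrite -(ltr_nat R) (lt_le_trans _ (_ : 1 <= k%:R)) ?ltr01 -?He.
case: f Hk => [|f] Hk; first by move: Hk k1; rewrite expn0; lia.
exists f => //.
eapply wp_weaken; [|shelve|by move=> r' m' _ _; exact: id].
apply: wp_seq; apply: wp_set; first by rewrite /= pnatr_eq0.
apply: wp_seq; apply: wp_set => //.
apply: wp_seq; apply: wp_set => //.
apply: wp_set => //; rewrite /= /upd /= He floor_half -pmulrn.
exists k./2; split=> //; first by move: Hk; rewrite expnS; lia.
have ok : k%:R = (odd k)%:R + 2 * (k./2)%:R :> R.
  by rewrite -{1}(odd_double_half k) natrD -mul2n natrM.
have bk : r vb ^+ k = r vb ^+ odd k * (r vb * r vb) ^+ k./2.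
  by rewrite -{1}(odd_double_half k) -mul2n exprD exprM expr2.
rewrite -HV bk ok.
by case: (odd k) => /=; rewrite ?expr0 ?expr1; ring.
Unshelve.
by vm_compute.
Qed.

(** The size bounds confine base and exponent to a register or a constant, which makes the cost a
    fixed linear function of [f]. The exponent is read after [vb] has been set, hence the updated
    state. *)
Lemma wp_pow d b e r m k f Q :
  edef b r -> edef e (upd r vb (denote b r)) ->
  denote e (upd r vb (denote b r)) = k%:R -> (k < 2 ^ f)%N ->
  (size (comp_expr b tmp) <= 2)%N -> (size (comp_expr e tmp) <= 2)%N ->
  (forall r', (forall i, i \notin writes (cpow d b e) -> r' i = r i) ->
     r' d = denote b r ^+ k -> Q r' m) ->
  wp (cpow d b e) r m (f * 50 + 40) Q.
Proof.
move=> db de He Hk sb se HQ.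
eapply (@wp_weaken _ _ _ _ _ _ (fun r' _ => r' d = denote b r ^+ k)).
- apply: wp_seq; apply: wp_set => //.
  apply: wp_seq; apply: wp_set => //.
  apply: wp_seq; apply: wp_set => //.
  apply: wp_seq.
  eapply wp_weaken; first apply: (@wp_while R (fun f r' m' => exists k',
    [/\ r' ve = k'%:R, (k' < 2 ^ f)%N & r' vacc * r' vb ^+ k' = denote b r ^+ k])
    _ _ _ _ _ f 40).
  + move=> f' r1 m1 _ _ [k' [H1 H2 H3]]; split=> // Hle.
    exact: wp_pow_body H1 H2 H3 Hle.
  + by exists k; rewrite /= /upd /= He mul1r; split.
  + exact: leqnn.
  + move=> r1 m1 _ _ [[f' [k' [H1 H2 H3]]] /= Hlt].
    apply: wp_set => //=; rewrite /upd eqxx -H3.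
    have -> : k' = 0%N by move: Hlt; rewrite H1 ltrn1; clear; case: k'.
    by rewrite expr0 mulr1.
- set t := pair_cost _ _; have -> : t = 3%N by [].
  by move: sb se; clear; rewrite /=; lia.
- by move=> r' m' F1 F2 Hd; rewrite F2 //; apply: HQ.
Qed.

End PowSpec.

(** For the item in [va], [vA] receives x^l / y^k, its term for joining X, and [vB] receives y^l /
    x^k, its term for joining Y. *)
Definition cfactor :=
  vk <- EFloor (#vK * #va) ;;
  vl <- EFloor (#vK * #vrho * #va) + $1 ;;
  cpow vp #vx #vk ;; cpow vq #vy #vk ;;
  cpow vu #vx #vl ;; cpow vv #vy #vl ;;
  vA <- #vu / #vq ;; vB <- #vv / #vp.

(** [vF] is the monomial of the decided items, and the items below [vi] are undecided. The answer is
    positive iff y^N <= [vG] at the end. *)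
Definition coracle :=
  vG <- #vF ;; vj <- #vi ;;
  CWhile $1 #vj
    (vj <- #vj - $1 ;; CLoad va #vj ;; cfactor ;;
     vG <- #vG * ($1 + #vA + #vB)) ;;
  vG <- EFloor (#vG * #vyN) ;;
  vG <- #vG - (#vx - $1) * EFloor (#vG / (#vx - $1)).

(** * Correctness and cost of the feasibility test *)

Section OracleSpec.
Variable R : realType.
Implicit Types (r m : nat -> R).

Lemma floor_truncn (z : R) : 0 <= z -> (Num.floor z)%:~R = (Num.truncn z)%:R :> R.
Proof. by move=> z0; rewrite truncn_floor z0 pmulrn gez0_abs // floor_ge0. Qed.

Lemma wp_factor r m f Q :
  let k := Num.truncn (r vK * r va) in
  let l := (Num.truncn (r vK * r vrho * r va)).+1 in
  0 <= r vK * r va -> 0 <= r vK * r vrho * r va -> r vx != 0 -> r vy != 0 ->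
  (k < 2 ^ f)%N -> (l < 2 ^ f)%N ->
  (forall r', (forall i, i \notin writes cfactor -> r' i = r i) ->
     r' vA = r vx ^+ l / r vy ^+ k -> r' vB = r vy ^+ l / r vx ^+ k -> Q r' m) ->
  wp cfactor r m (f * 200 + 220) Q.
Proof.
move=> k l Ka Kra x0 y0 kf lf HQ.
eapply (@wp_weaken _ _ _ _ _ _ (fun r' _ => r' vA = r vx ^+ l / r vy ^+ k /\
   r' vB = r vy ^+ l / r vx ^+ k)).
- apply: wp_seq; apply: wp_set => //.
  apply: wp_seq; apply: wp_set => //.
  set r0 := upd _ _ _.
  have k0 : r0 vk = k%:R by rewrite /r0 /= /upd /= floor_truncn.
  have l0 : r0 vl = l%:R by rewrite /r0 /= /upd /= floor_truncn // /l -natr1.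
  have xr : r0 vx = r vx by [].
  have yr : r0 vy = r vy by [].
  move: (r0) k0 l0 xr yr => {}r0 k0 l0 xr yr.
  apply: wp_seq; apply: (wp_pow (k := k) _ _ _ kf) => //= r1 F1 E1.
  apply: wp_seq; apply: (wp_pow (k := k) _ _ _ kf) => //=.
    by rewrite /upd /= F1.
  move=> r2 F2 E2.
  apply: wp_seq; apply: (wp_pow (k := l) _ _ _ lf) => //=.
    by rewrite /upd /= F2 // F1.
  move=> r3 F3 E3.
  apply: wp_seq; apply: (wp_pow (k := l) _ _ _ lf) => //=.
    by rewrite /upd /= F3 // F2 // F1.
  move=> r4 F4 E4.
  have p4 : r4 vp = r vx ^+ k by rewrite F4 // F3 // F2 // E1 /= xr.
  have q4 : r4 vq = r vy ^+ k by rewrite F4 // F3 // E2 /= F1 // yr.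
  have u4 : r4 vu = r vx ^+ l by rewrite F4 // E3 /= F2 // F1 // xr.
  have v4 : r4 vv = r vy ^+ l by rewrite E4 /= F3 // F2 // F1 // yr.
  apply: wp_seq; apply: wp_set; first by rewrite /= q4 expf_neq0.
  apply: wp_set; first by rewrite /= /upd /= p4 expf_neq0.
  by rewrite /= /upd /= p4 q4 u4 v4.
- rewrite /=; lia.
- by move=> r' m' F1 F2 [HA HB]; rewrite F2 //; apply: HQ.
Qed.

Variables (a : nat -> R) (Y N : nat).
Let y : R := Y%:R.
Let x : R := y * y * y ^+ N * y ^+ N.

Definition env (K rho : R) r :=
  [/\ r vK = K, r vrho = rho, r vy = y, r vyN = y ^+ N & r vx = x].

Hypothesis Y1 : (1 < Y)%N.

Lemma y_gt0 : 0 < y. Proof. by rewrite ltr0n ltnW. Qed.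

Lemma x_gt1 : 1 < x.
Proof.
have y1 : 1 < y by rewrite ltr1n.
have yN1 : 1 <= y ^+ N by rewrite exprn_ege1 // ltW.
have y2 : 1 < y * y by rewrite -[ltLHS]mulr1 ltr_pM.
have yNN : 1 <= y ^+ N * y ^+ N by rewrite -[leLHS]mulr1 ler_pM.
have -> : x = y * y * (y ^+ N * y ^+ N) by rewrite mulrA.
by apply: lt_le_trans y2 _; rewrite ler_peMr // mulr_ge0 // ltW // y_gt0.
Qed.

Section Spec.
Variables (K rho : R) (B f : nat).
Hypotheses (K0 : 0 < K) (rho0 : 0 <= rho).
Local Notation k := (rdown a K).
Local Notation l := (rup a K rho).

Lemma wp_coracle r m i p Q :
  env K rho r -> r vi = i%:R -> (forall j, (j < i)%N -> m j = a j) ->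
  (forall j, (j < i)%N -> 0 <= a j) ->
  (forall j, (j < i)%N -> (k j <= B)%N && (l j <= B)%N) -> (B < 2 ^ f)%N ->
  (3 ^ i < Y)%N -> (absz p.2 + i * B <= N)%N ->
  r vF = monomial x y p ->
  (forall r', (forall i, i \notin writes coracle -> r' i = r i) ->
     (y ^+ N <= r' vG) = feasible k l i p -> Q r' m) ->
  wp coracle r m (i * (f * 200 + 300) + 100) Q.
Proof.
move=> [eK erho ey eyN ex] ei Hm a0 HB Bf iY pN HF HQ.
have y0 := y_gt0; have x1 := x_gt1.
have xn0 : x != 0 by rewrite gt_eqF // (lt_trans ltr01).
have yn0 : y != 0 by rewrite gt_eqF.
eapply (@wp_weaken _ _ _ _ _ _
  (fun r' _ => (y ^+ N <= r' vG) = feasible k l i p)).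
- apply: wp_seq; apply: wp_set => //.
  apply: wp_seq; apply: wp_set => //.
  (* The items are multiplied in from the top; the factors of those below [j] are the ones still
     missing. *)
  apply: wp_seq; eapply wp_weaken; first apply: (@wp_while R (fun j r' _ =>
    [/\ (j <= i)%N, r' vj = j%:R &
      r' vG * \prod_(t < j) (1 + x ^+ l t / y ^+ k t + y ^+ l t / x ^+ k t) =
      \sum_(q <- exponents k l i p) monomial x y q])
    _ _ _ _ _ i (f * 200 + 280)).
  + move=> j r1 m1 F1 M1 [ji Hj HG]; split=> // /=; rewrite Hj => Hj1.
    case: j ji Hj HG Hj1 => [|j] ji Hj HG Hj1; first by move: Hj1; rewrite ler10.
    exists j => //.
    have {}M1 : m1 = m by rewrite M1.
    eapply wp_weaken; [|shelve|by move=> r' m' _ _; exact: id].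
    apply: wp_seq; apply: wp_set => //.
    have Hj' : r1 vj - 1%:~R = j%:R by rewrite Hj -natr1 addrK.
    apply: wp_seq; apply: (wp_load (j := j)) => //.
    have aj : m1 j = a j by rewrite M1 Hm.
    set r2 := upd _ _ _.
    have K2 : r2 vK = K by rewrite /r2 /upd /= F1.
    have rho2 : r2 vrho = rho by rewrite /r2 /upd /= F1.
    have x2 : r2 vx = x by rewrite /r2 /upd /= F1.
    have y2 : r2 vy = y by rewrite /r2 /upd /= F1.
    have a2 : r2 va = a j by rewrite /r2 /upd.
    have j2 : r2 vj = j%:R by rewrite /r2 /upd /= Hj'.
    have G2 : r2 vG = r1 vG by [].
    move: (r2) K2 rho2 x2 y2 a2 j2 G2 => {}r2 K2 rho2 x2 y2 a2 j2 G2.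
    have /andP[kB lB] := HB j ji.
    apply: wp_seq; apply: (wp_factor (f := f)); rewrite ?K2 ?rho2 ?a2 ?x2 ?y2 //.
    * by rewrite mulr_ge0 ?a0 // ltW.
    * by rewrite !mulr_ge0 ?a0 // ltW.
    * exact: leq_ltn_trans Bf.
    * exact: leq_ltn_trans Bf.
    move=> r3 F3 A3 B3; apply: wp_set => //; split; first exact: ltnW.
      by rewrite /upd /= F3.
    rewrite /upd /= A3 B3 F3 // G2 -HG big_ord_recr /= -mulrA; congr (_ * _).
    by rewrite mulrC.
  + split=> //; rewrite /= /upd /= HF; exact: prod_monomial.
  + exact: leqnn.
  + move=> r1 m1 F1 _ [[j [ji Hj HG]] /= Hlt].
    have j0 : j = 0%N by move: Hlt; rewrite Hj ltrn1; case: (j).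
    move: HG; rewrite j0 big_ord0 mulr1 => HG.
    have yN1 : r1 vyN = y ^+ N by rewrite F1.
    have xx1 : r1 vx = x by rewrite F1.
    apply: wp_seq; apply: wp_set => //.
    apply: wp_set; rewrite /= /upd /= xx1.
      by rewrite subr_eq0 gt_eqF.
    rewrite yN1 HG; apply: feasible_test => //.
      by rewrite size_exponents.
    by move=> q Hq; apply: leq_trans pN; apply: exponents_bound Hq.
- rewrite [pair_cost _ _]/=; clear; rewrite /pair_cost /=; lia.
- by move=> r' m' F1 F2 HE; rewrite F2 //; apply: HQ.
Unshelve.
by rewrite /=; clear; lia.
Qed.

End Spec.
End OracleSpec.

(** The output overwrites the input. Cell n - 1 is never written: it keeps the maximum, which is
    nonzero and so marks membership in X. *)
Definition cdominant :=
  vi <- #vn - $1 ;;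
  CWhile $1 #vi
    (vi <- #vi - $1 ;; CStore #vi $0 ;; CStore (#vn + #vi)%X $1).

(** N is n times a common bound for all k and l, valid for every ratio up to n; the bisection starts
    from the interval [1, n]. *)
Definition csetup :=
  cpow vy $4 #vn ;;
  vN <- #vn * (EFloor ($4 * #vn * #vn / #veps) + $1) ;;
  cpow vyN #vy #vN ;;
  vx <- #vy * #vy * #vyN * #vyN ;;
  vK <- $4 * #vn / (#veps * #vmax) ;;
  vlo <- $1 ;; vhi <- #vn ;; vi <- #vn - $1.

Definition cstart := va <- #vmax ;; cfactor ;; vF <- #vA.

Definition csearch_body :=
  vrho <- (#vlo + #vhi) / $2 ;; cstart ;; coracle ;;
  CIf #vyN #vG (vhi <- #vrho) (vlo <- #vrho).

Definition csearch := CWhile (#veps / $4)%X (#vhi - #vlo)%X csearch_body.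

(** [vC] is the monomial of the decisions so far, and [vS] saves the Y term, since the oracle
    overwrites [vB]. If X succeeds nothing is stored: the item, being positive, is its own mark. *)
Definition cextract_body :=
  vi <- #vi - $1 ;; CLoad va #vi ;; cfactor ;; vS <- #vB ;;
  vF <- #vC * #vA ;; coracle ;;
  CIf #vyN #vG (vC <- #vF)
    (vF <- #vC * #vS ;; coracle ;;
     CIf #vyN #vG
       (vC <- #vF ;; CStore #vi $0 ;; CStore (#vn + #vi)%X $1)
       (CStore #vi $0)).

Definition cextract :=
  vrho <- #vhi ;; cstart ;; vC <- #vF ;; CWhile $1 #vi cextract_body.

Definition cmain :=
  CLoad vmax (#vn - $1)%X ;; CLoad va (#vn - $2)%X ;;
  CIf (#vn * #va)%X #vmax cdominant (csetup ;; csearch ;; cextract).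

Lemma absz_sub_le (u : int) (v : nat) : (absz (u - v%:Z)%R <= absz u + v)%N.
Proof. lia. Qed.

Lemma absz_add_le (u : int) (v : nat) : (absz (u + v%:Z)%R <= absz u + v)%N.
Proof. lia. Qed.

Lemma midpoint (R : realType) (lo hi : R) : lo <= hi ->
  [/\ lo <= (lo + hi) / 2, (lo + hi) / 2 <= hi,
    hi - (lo + hi) / 2 = (hi - lo) / 2 & (lo + hi) / 2 - lo = (hi - lo) / 2].
Proof. by move=> H; split; lra. Qed.

(** * Correctness of bisection, extraction and the whole program *)

Section MainSpec.
Variables (R : realType) (J : {fset R}) (eps : R).
Implicit Types (r m : nat -> R).
Local Notation n := #|` J|.
Local Notation a := (nth 0 (items J)).
Hypotheses (J0 : forall x, x \in J -> 0 < x) (n2 : (2 <= n)%N).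
Hypothesis (eps01 : 0 < eps < 1).

Let n0 : (0 < n)%N. Proof. exact: ltnW. Qed.
Let ln : (n.-1 < n)%N. Proof. by rewrite prednK. Qed.
Let nE : n = n.-2.+2. Proof. by case: (n) n2 => [|[]]. Qed.
Let eps0 : 0 < eps. Proof. by case/andP: eps01. Qed.
Let max0 : 0 < a n.-1. Proof. exact: item_gt0. Qed.
Let a0 j : (j < n)%N -> 0 <= a j. Proof. by move=> /(item_gt0 J0)/ltW. Qed.

Lemma natr_subS (i : nat) : i.+1%:R - 1%:~R = i%:R :> R.
Proof. by rewrite -natr1 addrK. Qed.

Lemma wp_cdominant r : r vn = n%:R -> n%:R * a n.-2 <= a n.-1 ->
  wp cdominant r a (n * 40 + 40) (fun _ m =>
    SSR_L_solution J eps (select J (fun j => m j != 0))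
      (select J (fun j => m (n + j)%N != 0))).
Proof.
move=> rn Hdom.
eapply wp_weaken; [|shelve|by move=> r' m' _ _; exact: id].
apply: wp_seq; apply: wp_set => //.
(* Cells below [i] still hold positive items and count as nonzero; the cells from n on start with
   the default 0 of [nth]. *)
eapply wp_weaken; first apply: (@wp_while R (fun i r' m' =>
  [/\ (i <= n.-1)%N, r' vi = i%:R,
   (forall j, (j < n)%N -> (m' j != 0) = (j < i)%N || (j == n.-1)) &
   (forall j, (j < n)%N -> (m' (n + j)%N != 0) = (i <= j < n.-1)%N)])
   _ _ _ _ _ n.-1 30).
- move=> i r1 m1 F1 _ [ile Hi HX HY]; split=> // /=; rewrite Hi => Hi1.
  case: i ile Hi HX HY Hi1 => [|i] ile Hi HX HY Hi1; first by move: Hi1; rewrite ler10.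
  exists i => //.
  have n1 : r1 vn = n%:R by rewrite F1.
  eapply wp_weaken; [|shelve|by move=> r' m' _ _; exact: id].
  apply: wp_seq; apply: wp_set => //.
  apply: wp_seq; apply: (wp_store (j := i)) => //.
    by rewrite /= /upd /= Hi natr_subS.
  apply: (wp_store (j := n + i)) => //.
    by rewrite /= /upd /= Hi n1 natr_subS natrD.
  split; first exact: ltnW.
  + by rewrite /upd /= Hi natr_subS.
  + move=> j jn; rewrite /upd /= ltn_eqF ?ltn_addr //.
    have [->|ji] := eqVneq j i; first by rewrite eqxx ltnn /= ltn_eqF.
    by rewrite HX // ltnS [in RHS]ltn_neqAle ji.
  + move=> j jn; rewrite /upd /= eqn_add2l.
    have iln : (i < n + j)%N.
      by rewrite (leq_trans (leq_trans ile (leq_pred n))) // leq_addr.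
    have [->|ji] := eqVneq j i; first by rewrite leqnn ile oner_neq0.
    by rewrite gtn_eqF // HY // [in RHS]leq_eqVlt eq_sym (negPf ji).
- split=> //.
  + by rewrite /= /upd /= rn -[in LHS](prednK n0) natr_subS.
  + move=> j jn; rewrite gt_eqF ?item_gt0 //=; apply/esym.
    by rewrite orbC -leq_eqVlt -ltnS prednK.
  + move=> j jn; rewrite nth_default ?eqxx ?size_items ?leq_addr //.
    by case: ltngtP.
- exact: leqnn.
- move=> r1 m1 _ _ [[i [ile Hi HX HY]] /= Hlt].
  have i0 : i = 0%N by move: Hlt; rewrite Hi ltrn1; case: (i).
  apply: dominant_solution => // j jn.
    by rewrite HX // i0.
  by rewrite HY // i0 /= ltn_neqAle -ltnS prednK // jn andbT.
Unshelve.
- by rewrite /=; clear; rewrite /pair_cost /=; lia.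
- by clear.
Qed.

Local Notation K := (4 * n%:R / (eps * a n.-1)).
Local Notation B := (Num.truncn (4 * n%:R * n%:R / eps)).+1.
Local Notation N := (n * B)%N.
Local Notation Y := (4 ^ n)%N.
Local Notation y := (Y%:R : R).
Local Notation x := (y * y * y ^+ N * y ^+ N).
Local Notation k := (rdown a K).
Local Notation l := (rup a K).
(** One number bounds both the squarings for every exponent that occurs and the bisection steps. It
    is finally taken to be the bit length of N. *)
Variable f : nat.
Hypothesis Nf : (N < 2 ^ f)%N.

Let Y1 : (1 < Y)%N. Proof. by rewrite -(expn0 4) ltn_exp2l. Qed.
Let K0 : 0 < K. Proof. by rewrite divr_gt0 ?mulr_gt0 ?ltr0n. Qed.
Let Bf : (B < 2 ^ f)%N.
Proof. by apply: leq_ltn_trans Nf; rewrite leq_pmull. Qed.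
Let n1R : 1 <= n%:R :> R. Proof. by rewrite ler1n. Qed.

(** K times the maximum is 4 n / eps, and the ratio adds a factor of at most n; the successor in [B]
    matches the one in [rup]. *)
Lemma rounding_bound rho j : rho <= n%:R -> (j < n)%N ->
  (k j <= B)%N && (l rho j <= B)%N.
Proof.
move=> rn jn.
have aj : a j <= a n.-1 by apply: le_items => //; rewrite -ltnS prednK.
have Kaj : K * a j <= 4 * n%:R / eps.
  apply: (@le_trans _ _ (K * a n.-1)); first by rewrite ler_pM2l.
  by rewrite le_eqVlt; apply/orP; left; apply/eqP; field; rewrite !gt_eqF.
have aj0 := a0 jn.
apply/andP; split.
  apply: leqW; apply: le_truncn; apply: (le_trans Kaj).
  by rewrite [leRHS]mulrAC ler_peMr // divr_ge0 ?mulr_ge0 ?ler0n // ltW.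
rewrite /rup ltnS; apply: le_truncn; rewrite mulrAC.
apply: (@le_trans _ _ (K * a j * n%:R)).
  by rewrite ler_wpM2l // mulr_ge0 // ltW.
by rewrite [leRHS]mulrAC ler_wpM2r.
Qed.

Lemma start_bound rho : rho <= n%:R ->
  (absz (start J K rho).2 + n.-1 * B <= N)%N.
Proof.
move=> rn; have /andP[kB _] := rounding_bound rn ln.
by rewrite /start /= abszN absz_nat -[X in (_ <= X * _)%N](prednK n0) mulSn leq_add2r.
Qed.

Lemma wp_cstart r m rho Q : env Y N K rho r -> 0 <= rho <= n%:R ->
  r vmax = a n.-1 ->
  (forall r', (forall i, i \notin writes cstart -> r' i = r i) ->
     r' vF = monomial x y (start J K rho) -> Q r' m) ->
  wp cstart r m (f * 200 + 240) Q.
Proof.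
move=> [eK erho ey eyN ex] /andP[rho0 rn] em HQ.
have y0 := y_gt0 R Y1; have x1 := x_gt1 R N Y1.
have xn0 : x != 0 by rewrite gt_eqF // (lt_trans ltr01).
have yn0 : y != 0 by rewrite gt_eqF.
have /andP[kB lB] := rounding_bound rn ln.
eapply (@wp_weaken _ _ _ _ _ _
  (fun r' _ => r' vF = monomial x y (start J K rho))).
- apply: wp_seq; apply: wp_set => //.
  set r1 := upd _ _ _.
  have K1 : r1 vK = K by [].
  have rho1 : r1 vrho = rho by [].
  have xx1 : r1 vx = x by [].
  have y1 : r1 vy = y by [].
  have a1 : r1 va = a n.-1 by [].
  move: (r1) K1 rho1 xx1 y1 a1 => {}r1 K1 rho1 xx1 y1 a1.
  apply: wp_seq; apply: (wp_factor (f := f)); rewrite ?K1 ?rho1 ?a1 ?xx1 ?y1 //.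
  + exact: (mulr_ge0 (ltW K0) (ltW max0)).
  + exact: (mulr_ge0 (mulr_ge0 (ltW K0) rho0) (ltW max0)).
  + exact: leq_ltn_trans Bf.
  + exact: leq_ltn_trans Bf.
  move=> r2 F2 A2 B2; apply: wp_set => //.
  by rewrite /upd /= A2 /monomial /start /= -exprnN -exprnP.
- by clear; rewrite /=; lia.
- by move=> r' m' F1 F2 HE; rewrite F2 //; apply: HQ.
Qed.

Let Y3 i : (i <= n)%N -> (3 ^ i < Y)%N.
Proof.
move=> Hi; apply: (@leq_ltn_trans (3 ^ n)); first by rewrite leq_exp2l.
by rewrite ltn_exp2r.
Qed.

(** The two ends carry different certificates: [lo] is a lower bound on the optimum, while [hi]
    passes the rounded test and so leads to a pair. *)
Definition search_inv lo hi :=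
  [/\ 1 <= lo, lo <= hi, hi <= n%:R, (lo%:E <= OPT_L J)%E &
      feasible k (l hi) n.-1 (start J K hi)].

(** The fuel bounds the gap by eps/4 * 2^f and each round halves the gap; without fuel the guard
    fails. *)
Lemma wp_csearch r m : r veps = eps -> r vmax = a n.-1 ->
  r vi = n.-1%:R -> env Y N K (r vrho) r ->
  (forall j, (j < n)%N -> m j = a j) -> search_inv (r vlo) (r vhi) ->
  r vhi - r vlo < eps / 4 * 2 ^+ f ->
  wp csearch r m (f * (n * (f * 200 + 300) + f * 200 + 500) + 20)
    (fun r' m' => search_inv (r' vlo) (r' vhi) /\ r' vhi <= r' vlo + eps / 4).
Proof.
move=> reps rmax ri [eK erho ey eyN ex] Hm Hinv Hf.
eapply wp_weaken; first apply: (@wp_while R (fun f' r' _ =>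
  search_inv (r' vlo) (r' vhi) /\ r' vhi - r' vlo < eps / 4 * 2 ^+ f')
  _ _ _ _ _ f (n * (f * 200 + 300) + f * 200 + 400)).
- move=> f' r1 m1 F1 M1 [[lo1 lohi hin Hlo Hhi] Hf']; split=> //=.
    by rewrite pnatr_eq0.
  have e1 : r1 veps = eps by rewrite F1.
  rewrite e1 => Hle.
  case: f' Hf' => [|f'] Hf'.
    by move: Hf'; rewrite expr0 mulr1 ltNge Hle.
  exists f' => //.
  have {}M1 : m1 = m by rewrite M1.
  eapply wp_weaken; [|shelve|by move=> r' m' _ _; exact: id].
  apply: wp_seq; apply: wp_set; first by rewrite /= pnatr_eq0.
  set rho := denote _ _; set r2 := upd _ _ _.
  have rhoE : rho = (r1 vlo + r1 vhi) / 2 by [].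
  have [lorho rhohi Hhalf Hhalf'] := midpoint lohi.
  rewrite -rhoE in lorho rhohi Hhalf Hhalf'.
  have rho1 : 1 <= rho by exact: le_trans lorho.
  have rhob : 0 <= rho <= n%:R.
    by rewrite (le_trans ler01 rho1) (le_trans rhohi).
  have env2 : env Y N K rho r2 by split; rewrite /r2 /upd /= ?F1.
  have max2 : r2 vmax = a n.-1 by rewrite /r2 /upd /= F1.
  have i2 : r2 vi = n.-1%:R by rewrite /r2 /upd /= F1.
  have lo2 : r2 vlo = r1 vlo by [].
  have hi2 : r2 vhi = r1 vhi by [].
  move: (r2) env2 max2 i2 lo2 hi2 => {}r2 env2 max2 i2 lo2 hi2.
  apply: wp_seq; apply: (wp_cstart env2) => // r3 F3 HF3.
  have env3 : env Y N K rho r3.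
    by case: env2 => ? ? ? ? ?; split; rewrite F3.
  have [rho0 rhon] := andP rhob.
  apply: wp_seq.
  apply: (wp_coracle (i := n.-1) (p := start J K rho) (B := B) (f := f) Y1 K0 rho0 env3).
  + by rewrite F3.
  + by move=> j jn; rewrite M1 Hm // (leq_trans jn) // leq_pred.
  + by move=> j jn; apply: a0; rewrite (leq_trans jn) // leq_pred.
  + by move=> j jn; apply: rounding_bound => //; rewrite (leq_trans jn) // leq_pred.
  + exact: Bf.
  + by rewrite Y3 // leq_pred.
  + exact: start_bound.
  + exact: HF3.
  move=> r4 F4 HG.
  have [_ erho3 _ eyN3 _] := env3.
  have rho4 : r4 vrho = rho by rewrite F4.
  have lo4 : r4 vlo = r1 vlo by rewrite F4 // F3.
  have hi4 : r4 vhi = r1 vhi by rewrite F4 // F3.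
  apply: (wp_if (T := 4)) => //=; rewrite F4 // eyN3 HG.
  have Hf2 : (r1 vhi - r1 vlo) / 2 < eps / 4 * 2 ^+ f'.
    by rewrite ltr_pdivrMr // -(mulrA (eps / 4)) -exprSr.
  case: ifP => Hfeas.
    apply: wp_set => //; rewrite /upd /= lo4 rho4; split; last by rewrite Hhalf'.
    by split.
  apply: wp_set => //; rewrite /upd /= hi4 rho4; split; last by rewrite Hhalf.
  split=> //.
  by apply: (infeasible_lower_bound J0 n0 K0); rewrite Hfeas.
- by [].
- by clear; rewrite /pair_cost /=; lia.
- move=> r1 m1 F1 _ [[f' [Hi _]] /=]; rewrite (F1 1%N) // reps => Hlt; split=> //.
  by rewrite -lerBlDl ltW.
Unshelve.
have := leq_pred n; move: (n) (f) => u v; clear => Hu.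
rewrite /pair_cost /=.
have : (u.-1 * (v * 200 + 300) <= u * (v * 200 + 300))%N by rewrite leq_mul2r Hu orbT.
by lia.
Qed.

Lemma wp_csetup r m : r vn = n%:R -> r veps = eps -> r vmax = a n.-1 ->
  wp csetup r m (f * 100 + 200) (fun r' _ =>
    [/\ env Y N K (r' vrho) r', r' vlo = 1, r' vhi = n%:R & r' vi = n.-1%:R]).
Proof.
move=> rn re rm.
have nf : (n < 2 ^ f)%N by apply: leq_ltn_trans Nf; rewrite leq_pmulr.
eapply wp_weaken; [|shelve|by move=> r' m' _ _; exact: id].
apply: wp_seq; apply: (wp_pow (k := n) _ _ _ nf) => // r1 F1 E1.
have n1 : r1 vn = n%:R by rewrite F1.
have e1 : r1 veps = eps by rewrite F1.
have m1 : r1 vmax = a n.-1 by rewrite F1.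
have {}E1 : r1 vy = y by rewrite E1 /= natrX.
apply: wp_seq; apply: wp_set; first by rewrite /= e1 gt_eqF.
set r2 := upd _ _ _.
have N2 : r2 vN = N%:R.
  rewrite /r2 /upd /= n1 e1 floor_truncn; last first.
    by rewrite divr_ge0 ?mulr_ge0 ?ler0n // ltW.
  by rewrite natrM -natr1.
have n2' : r2 vn = n%:R by [].
have e2 : r2 veps = eps by [].
have m2 : r2 vmax = a n.-1 by [].
have y2 : r2 vy = y by [].
move: (r2) N2 n2' e2 m2 y2 => {}r2 N2 n2' e2 m2 y2.
apply: wp_seq; apply: (wp_pow (k := N) _ _ _ Nf) => // r3 F3 E3.
have n3 : r3 vn = n%:R by rewrite F3.
have e3 : r3 veps = eps by rewrite F3.
have m3 : r3 vmax = a n.-1 by rewrite F3.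
have y3 : r3 vy = y by rewrite F3.
have {}E3 : r3 vyN = y ^+ N by rewrite E3 /= y2.
apply: wp_seq; apply: wp_set => //.
apply: wp_seq; apply: wp_set.
  by rewrite /= /upd /= e3 m3 mulf_neq0 // gt_eqF.
apply: wp_seq; apply: wp_set => //.
apply: wp_seq; apply: wp_set => //.
apply: wp_set => //; rewrite /env /upd /= n3 e3 m3 y3 E3; split=> //.
by rewrite -[in LHS](prednK n0) natr_subS.
Unshelve.
by clear; rewrite /=; lia.
Qed.

(** The witness puts the largest item against the second largest, a pair of ratio at most n when no
    item dominates. *)
Lemma initial_feasible : a n.-1 < n%:R * a n.-2 ->
  feasible k (l n%:R) n.-1 (start J K n%:R).
Proof.
move=> Hlt.
have ln2 : (n.-2 < n)%N by rewrite {2}nE ltnS leqnSn.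
have ll : n.-1 = n.-2.+1 by rewrite {1}nE.
apply: (feasible_of_ratio J0 n0 K0 (f := fun j => j == n.-1)
  (g := fun j => j == n.-2)) => //.
- by move=> j _; apply/andP => -[/eqP-> /eqP]; rewrite {1}ll => /eqP; rewrite gtn_eqF.
- by rewrite !selsum_pred1 // ltW.
- rewrite !selsum_pred1 //.
  have le2 : a n.-2 <= a n.-1 by apply: le_items => //; rewrite {2}ll.
  by apply: (le_trans le2); rewrite ler_peMl // ltW.
Qed.

Section Extract.
Variable rho : R.
Hypotheses (rho1 : 1 <= rho) (rhon : rho <= n%:R).

Let rho0 : 0 <= rho. Proof. exact: le_trans rho1. Qed.

(* Exponents contributed by the decided items [i], ..., [n - 1]. *)
Definition decided m i : int * int :=
  ((\sum_(i <= j < n) (m j != 0%R) * l rho j)%N%:Z -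
     (\sum_(i <= j < n) (m (n + j)%N != 0%R) * k j)%N%:Z,
   (\sum_(i <= j < n) (m (n + j)%N != 0%R) * l rho j)%N%:Z -
     (\sum_(i <= j < n) (m j != 0%R) * k j)%N%:Z).

Lemma decided_step m m' i : (i < n)%N ->
  (forall j, (i < j)%N -> (j < n)%N -> m' j = m j /\ m' (n + j)%N = m (n + j)%N) ->
  decided m' i =
    ((decided m i.+1).1 + ((m' i != 0%R) * l rho i)%N%:Z
       - ((m' (n + i)%N != 0%R) * k i)%N%:Z,
     (decided m i.+1).2 + ((m' (n + i)%N != 0%R) * l rho i)%N%:Z
       - ((m' i != 0%R) * k i)%N%:Z).
Proof.
move=> iln Hm.
have E1 (h : nat -> nat) : (\sum_(i <= j < n) (m' j != 0%R) * h j =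
    (m' i != 0%R) * h i + \sum_(i.+1 <= j < n) (m j != 0%R) * h j)%N.
  rewrite big_ltn //; congr addn; apply: eq_big_nat => j /andP[ij jn].
  by rewrite (Hm j ij jn).1.
have E2 (h : nat -> nat) : (\sum_(i <= j < n) (m' (n + j)%N != 0%R) * h j =
    (m' (n + i)%N != 0%R) * h i +
      \sum_(i.+1 <= j < n) (m (n + j)%N != 0%R) * h j)%N.
  rewrite big_ltn //; congr addn; apply: eq_big_nat => j /andP[ij jn].
  by rewrite (Hm j ij jn).2.
rewrite {1}/decided !E1 !E2 /decided /=.
congr (_, _); rewrite !PoszD; ring.
Qed.

(** Cells below [i] still contain the input, which the oracle reads. The last bound leaves i * B of
    the budget N = n * B to the undecided items. *)
Definition extract_inv i r m :=
  [/\ (i < n)%N /\ r vi = i%:R,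
      (forall j, (j < i)%N -> m j = a j /\ m (n + j)%N = 0),
      (forall j, (i <= j < n)%N -> ~~ ((m j != 0) && (m (n + j)%N != 0)))
        /\ m n.-1 != 0,
      r vC = monomial x y (decided m i) &
      feasible k (l rho) i (decided m i) /\
      (absz (decided m i).2 <= (n - i) * B)%N].

Lemma extract_inv_step i r m r' m' : extract_inv i.+1 r m ->
  (forall j, j != i -> (j < n)%N -> m' j = m j /\ m' (n + j)%N = m (n + j)%N) ->
  ~~ ((m' i != 0) && (m' (n + i)%N != 0)) ->
  r' vi = i%:R -> r' vC = monomial x y (decided m' i) ->
  feasible k (l rho) i (decided m' i) ->
  (absz (decided m' i).2 <= (n - i) * B)%N ->
  extract_inv i r' m'.
Proof.
move=> [[iln _] Hm [Hd Hn] _ _] Hm' Hi ri rC Hf Hb; split=> //.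
- by split=> //; exact: ltnW.
- move=> j ji; have jn : (j < n)%N by rewrite (ltn_trans ji) // ltnW.
  have [-> ->] : m' j = m j /\ m' (n + j)%N = m (n + j)%N.
    by apply: Hm' => //; rewrite ltn_eqF.
  by apply: Hm; rewrite ltnS ltnW.
- split.
    move=> j /andP[ij jn]; have [->//|ji] := eqVneq j i.
    have [-> ->] := Hm' j ji jn.
    by apply: Hd; rewrite ltn_neqAle eq_sym ji ij.
  have [] := Hm' n.-1 _ ln; last by move=> ->.
  by rewrite gtn_eqF // -ltnS prednK.
Qed.

(** Three branches, one for each disjunct of [feasibleS]; after two negative tests, leaving the item
    out must remain feasible. *)
Lemma wp_cextract_body i r m : env Y N K rho r -> r vn = n%:R ->
  extract_inv i.+1 r m ->
  wp cextract_body r m (n * (f * 400 + 600) + f * 200 + 600) (extract_inv i).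
Proof.
move=> [eK erho ey eyN ex] rn Hinv.
have [[iln ri] Hm [Hd Hn] rC [Hf Hb]] := Hinv.
have i_lt : (i < n)%N by exact: ltnW.
have [mi mni] := Hm i (ltnSn i).
have y0 := y_gt0 R Y1; have x1 := x_gt1 R N Y1.
have xn0 : x != 0 by rewrite gt_eqF // (lt_trans ltr01).
have yn0 : y != 0 by rewrite gt_eqF.
have /andP[kB lB] := rounding_bound rhon i_lt.
set p := decided m i.+1 in rC Hf Hb.
have nBE : (n - i = (n - i.+1).+1)%N by rewrite subnSK.
have bX : (absz (addX k (l rho) p i).2 <= (n - i) * B)%N.
  by rewrite nBE mulSnr (leq_trans (absz_sub_le _ _)) // leq_add.
have bY : (absz (addY k (l rho) p i).2 <= (n - i) * B)%N.
  by rewrite nBE mulSnr (leq_trans (absz_add_le _ _)) // leq_add.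
have bN b : (b <= (n - i) * B)%N -> (b + i * B <= N)%N.
  move=> Hb'; apply: (@leq_trans ((n - i) * B + i * B)); first by rewrite leq_add2r.
  by rewrite -mulnDl subnK // ltnW.
eapply wp_weaken; [|shelve|by move=> r' m' _ _; exact: id].
apply: wp_seq; apply: wp_set => //.
apply: wp_seq; apply: (wp_load (j := i)) => //.
  by rewrite /= /upd /= ri natr_subS.
set r1 := upd _ _ _.
have env1 : env Y N K rho r1 by split.
have n1 : r1 vn = n%:R by [].
have i1 : r1 vi = i%:R by rewrite /r1 /upd /= ri natr_subS.
have C1 : r1 vC = monomial x y p by [].
have a1 : r1 va = a i by [].
move: (r1) env1 n1 i1 C1 a1 => {}r1 env1 n1 i1 C1 a1.
have [K1 rho1' y1 _ xx1] := env1.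
apply: wp_seq; apply: (wp_factor (f := f)); rewrite ?K1 ?rho1' ?a1 ?xx1 ?y1 //.
- exact: (mulr_ge0 (ltW K0) (a0 i_lt)).
- exact: (mulr_ge0 (mulr_ge0 (ltW K0) rho0) (a0 i_lt)).
- exact: leq_ltn_trans Bf.
- exact: leq_ltn_trans Bf.
move=> r2 F2 A2 B2.
apply: wp_seq; apply: wp_set => //.
apply: wp_seq; apply: wp_set => //.
set r3 := upd _ _ _.
have env3 : env Y N K rho r3.
  by case: env1 => ? ? ? ? ?; split; rewrite /r3 /upd /= F2.
have n3 : r3 vn = n%:R by rewrite /r3 /upd /= F2.
have i3 : r3 vi = i%:R by rewrite /r3 /upd /= F2.
have C3 : r3 vC = monomial x y p by rewrite /r3 /upd /= F2.
have F3 : r3 vF = monomial x y (addX k (l rho) p i).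
  by rewrite monomialX // /r3 /upd /= A2 F2 // C1.
have S3 : monomial x y p * r3 vS = monomial x y (addY k (l rho) p i).
  by rewrite monomialY // /r3 /upd /= B2.
move: (r3) env3 n3 i3 C3 F3 S3 => {}r3 env3 n3 i3 C3 F3 S3.
have [_ _ _ yN3 _] := env3.
have oracle_items j : (j < i)%N -> m j = a j.
  by move=> ji; case: (Hm j) => //; rewrite ltnS ltnW.
have oracle_pos j : (j < i)%N -> 0 <= a j.
  by move=> ji; apply: a0; apply: ltn_trans i_lt.
have oracle_bound j : (j < i)%N -> (k j <= B)%N && (l rho j <= B)%N.
  by move=> ji; apply: rounding_bound => //; apply: ltn_trans i_lt.
have iY : (3 ^ i < Y)%N by apply/Y3/ltnW.
apply: wp_seq; apply: (wp_coracle Y1 K0 rho0 env3 i3 oracle_items oracle_pos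
  oracle_bound Bf iY (bN _ bX) F3) => r4 F4 HG.
have C4 : r4 vC = monomial x y p by rewrite F4.
have i4 : r4 vi = i%:R by rewrite F4.
have n4 : r4 vn = n%:R by rewrite F4.
have F4' : r4 vF = r3 vF by rewrite F4.
have S4 : r4 vS = r3 vS by rewrite F4.
have env4 : env Y N K rho r4 by case: env3 => ? ? ? ? ?; split; rewrite F4.
have yN4 : r4 vyN = y ^+ N by rewrite F4.
apply: (wp_if (T := n * (f * 200 + 300) + 160)) => //=.
rewrite yN4 HG; case: ifP => feasX.
  eapply wp_weaken; [|shelve|by move=> r' m' _ _; exact: id].
  (* The memory is unchanged, yet item [i] now counts as decided for X because its cell holds a
     nonzero value. *)
  have dE : decided m i = addX k (l rho) p i.
    rewrite (@decided_step m m) // mi mni eqxx gt_eqF ?item_gt0 //=.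
    by rewrite !mul0n !mul1n subr0 addr0.
  apply: wp_set => //; apply: extract_inv_step Hinv _ _ _ _ _ _ => //.
  - by rewrite mni eqxx andbF.
  - by rewrite dE /upd /= F4'.
  - by rewrite dE.
  - by rewrite dE.
eapply wp_weaken; [|shelve|by move=> r' m' _ _; exact: id].
apply: wp_seq; apply: wp_set => //.
set r5 := upd _ _ _.
have env5 : env Y N K rho r5 by case: env4 => ? ? ? ? ?; split.
have n5 : r5 vn = n%:R by [].
have i5 : r5 vi = i%:R by [].
have C5 : r5 vC = monomial x y p by [].
have F5 : r5 vF = monomial x y (addY k (l rho) p i).
  by rewrite /r5 /upd /= C4 S4.
move: (r5) env5 n5 i5 C5 F5 => {}r5 env5 n5 i5 C5 F5.
apply: wp_seq; apply: (wp_coracle Y1 K0 rho0 env5 i5 oracle_items oracle_pos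
  oracle_bound Bf iY (bN _ bY) F5) => r6 F6 HG6.
have C6 : r6 vC = monomial x y p by rewrite F6.
have i6 : r6 vi = i%:R by rewrite F6.
have n6 : r6 vn = n%:R by rewrite F6.
have F6' : r6 vF = r5 vF by rewrite F6.
have yN6 : r6 vyN = y ^+ N by case: env5 => _ _ _ ? _; rewrite F6.
have ni j : (j < n)%N -> (j == n + i)%N = false.
  by move=> jn; rewrite ltn_eqF // ltn_addr.
apply: (wp_if (T := 30)) => //=; rewrite yN6 HG6; case: ifP => feasY.
  eapply wp_weaken; [|shelve|by move=> r' m' _ _; exact: id].
  apply: wp_seq; apply: wp_set => //.
  apply: wp_seq; apply: (wp_store (j := i)) => //.
  apply: (wp_store (j := n + i)) => //.
    by rewrite /= /upd /= n6 i6 natrD.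
  set m' := upd (upd m _ _) _ _.
  have mi' : m' i = 0 by rewrite /m' /upd ni // eqxx.
  have mni' : m' (n + i)%N = 1 by rewrite /m' /upd eqxx.
  have mj' j : j != i -> (j < n)%N -> m' j = m j /\ m' (n + j)%N = m (n + j)%N.
    move=> ji jn; rewrite /m' /upd ni // (negPf ji) eqn_add2l (negPf ji).
    by rewrite [(n + j == i)%N]gtn_eqF // ltn_addr.
  have dE : decided m' i = addY k (l rho) p i.
    rewrite (@decided_step m m') //; last first.
      by move=> j ij jn; apply: mj' => //; rewrite gtn_eqF.
    by rewrite mi' mni' eqxx oner_neq0 /= !mul0n !mul1n subr0 addr0.
  apply: extract_inv_step Hinv mj' _ _ _ _ _ => //.
  - by rewrite mi' eqxx.
  - by rewrite dE /upd /= F6'.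
  - by rewrite dE.
  - by rewrite dE.
eapply wp_weaken; [|shelve|by move=> r' m' _ _; exact: id].
apply: (wp_store (j := i)) => //.
set m' := upd m _ _.
have mi' : m' i = 0 by rewrite /m' /upd eqxx.
have mni' : m' (n + i)%N = 0 by rewrite /m' /upd eq_sym ni.
have mj' j : j != i -> (j < n)%N -> m' j = m j /\ m' (n + j)%N = m (n + j)%N.
  move=> ji jn; rewrite /m' /upd (negPf ji).
  by rewrite [(n + j == i)%N]gtn_eqF // ltn_addr.
have dE : decided m' i = p.
  rewrite (@decided_step m m') //; last first.
    by move=> j ij jn; apply: mj' => //; rewrite gtn_eqF.
  by rewrite mi' mni' eqxx -/p; case: (p) => p1 p2 /=; rewrite !mul0n !addrK.
apply: extract_inv_step Hinv mj' _ _ _ _ _ => //.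
- by rewrite mi' eqxx.
- by rewrite dE.
- by rewrite dE; move: Hf; rewrite feasibleS feasX feasY !orbF.
- by rewrite dE (leq_trans Hb) // leq_mul2r leq_sub2l ?orbT.
Unshelve.
- have := leq_mul (ltnW i_lt) (leqnn (f * 200 + 300)).
  rewrite (_ : (n * (f * 400 + 600) = n * (f * 200 + 300) * 2)%N); last first.
    by rewrite -mulnA; congr muln; clear; lia.
  move: (i * (f * 200 + 300))%N (n * (f * 200 + 300))%N => u v.
  by clear; rewrite /pair_cost /=; lia.
- by move: (n * (f * 200 + 300))%N => u; clear; rewrite /=; lia.
- have := leq_mul (ltnW i_lt) (leqnn (f * 200 + 300)).
  move: (i * (f * 200 + 300))%N (n * (f * 200 + 300))%N => u v.
  by clear; rewrite /pair_cost /=; lia.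
- by clear.
- by clear.
Qed.

Lemma wp_cextract r lo : env Y N K (r vrho) r -> r vn = n%:R ->
  r vmax = a n.-1 -> r vi = n.-1%:R -> r vhi = rho ->
  (lo%:E <= OPT_L J)%E -> 1 <= lo -> rho <= lo + eps / 4 ->
  feasible k (l rho) n.-1 (start J K rho) ->
  wp cextract r a (n * (n * (f * 400 + 600) + f * 200 + 700) + f * 200 + 300)
    (fun _ m =>
    SSR_L_solution J eps (select J (fun j => m j != 0))
      (select J (fun j => m (n + j)%N != 0))).
Proof.
move=> [eK erho ey eyN ex] rn rm ri rhi Hlo lo1 Hrho Hfeas.
eapply wp_weaken; [|shelve|by move=> r' m' _ _; exact: id].
apply: wp_seq; apply: wp_set => //.
set r1 := upd _ _ _.
have env1 : env Y N K rho r1 by split.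
have n1 : r1 vn = n%:R by [].
have m1 : r1 vmax = a n.-1 by [].
have i1 : r1 vi = n.-1%:R by [].
move: (r1) env1 n1 m1 i1 => {}r1 env1 n1 m1 i1.
apply: wp_seq; apply: (wp_cstart env1) => //; first by rewrite rho0.
move=> r2 F2 HF2.
apply: wp_seq; apply: wp_set => //.
set r3 := upd _ _ _.
have env3 : env Y N K rho r3.
  by case: env1 => ? ? ? ? ?; split; rewrite /r3 /upd /= F2.
have n3 : r3 vn = n%:R by rewrite /r3 /upd /= F2.
have i3 : r3 vi = n.-1%:R by rewrite /r3 /upd /= F2.
have C3 : r3 vC = monomial x y (start J K rho) by [].
move: (r3) env3 n3 i3 C3 => {}r3 env3 n3 i3 C3.
have aY j : a (n + j)%N = 0 by rewrite nth_default // size_items leq_addr.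
(* The untouched input already encodes the initial decision: cell n - 1 is nonzero and cell 2n - 1
   is 0. *)
have dE : decided a n.-1 = start J K rho.
  have E (h : nat -> nat) : (\sum_(n.-1 <= j < n) h j = h n.-1)%N.
    by rewrite -[X in (\sum_(_ <= _ < X) _)%N](prednK n0) big_nat1.
  rewrite /decided (E (fun j => (a j != 0%R) * l rho j)%N).
  rewrite (E (fun j => (a (n + j)%N != 0%R) * k j)%N).
  rewrite (E (fun j => (a (n + j)%N != 0%R) * l rho j)%N).
  rewrite (E (fun j => (a j != 0%R) * k j)%N).
  by rewrite !aY eqxx gt_eqF //= !mul0n !mul1n subr0 sub0r.
eapply wp_weaken; first apply: (@wp_while R extract_inv _ _ _ _ _ n.-1
  (n * (f * 400 + 600) + f * 200 + 600)).
- move=> i r4 m4 F4 _ Hinv; split=> // /=.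
  have [[iln Hi] _ _ _ _] := Hinv; rewrite Hi => Hi1.
  case: i Hi Hi1 iln Hinv => [|i] Hi Hi1 iln Hinv; first by move: Hi1; rewrite ler10.
  exists i => //; apply: wp_cextract_body => //; last by rewrite F4.
  by case: env3 => ? ? ? ? ?; split; rewrite F4.
- split=> //.
  + split; last by rewrite gt_eqF.
    by move=> j _; rewrite aY eqxx andbF.
  + by rewrite dE.
  + rewrite dE; split=> //; rewrite /start /= abszN absz_nat.
    by have /andP[kB _] := rounding_bound rhon ln; rewrite (leq_trans kB) // leq_pmull // subn_gt0.
- exact: leqnn.
- move=> r4 m4 _ _ [[i Hinv] /= Hlt].
  have [[iln Hi] _ [Hd Hn] _ [Hf _]] := Hinv.
  have i0 : i = 0%N by move: Hlt; rewrite Hi ltrn1; case: (i).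
  rewrite i0 in Hd Hf.
  (* With no item undecided, feasibility says that both exponents are nonnegative, which are the two
     rounded inequalities. *)
  move: Hf; rewrite /feasible /= orbF /decided /= !big_mkord !subr_ge0 !lez_nat.
  move=> /andP[H1 H2].
  exact: (rounded_solution J0 n0 eps01 _ _ Hlo lo1 rho0 Hrho).
Unshelve.
have := leq_pred n; move: (n) => u; move: (f) => v; clear => Hu.
have -> : (u * (u * (v * 400 + 600) + v * 200 + 700) =
  u * (u * (v * 400 + 600) + v * 200 + 600 + 100))%N.
  by congr muln; move: (u * _)%N => z; lia.
move: (u * (v * 400 + 600) + v * 200 + 600)%N => w.
have := leq_mul Hu (leqnn (w + 100)); rewrite /pair_cost /= => H.
have H' : (u.-1 * (3 + w + 2) <= u.-1 * (w + 100))%N by rewrite leq_mul2l; lia.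
by move: H H'; move: (u.-1 * _)%N (u.-1 * _)%N (u * _)%N => z1 z2 z3; lia.
Qed.

End Extract.

Definition main_cost (u v : nat) : nat :=
  (v * (u * (v * 200 + 300) + v * 200 + 500) +
   (u * (u * (v * 400 + 600) + v * 200 + 700) + (v * 300 + u * 40 + 700)))%N.

Lemma wp_cmain r : r vn = n%:R -> r veps = eps ->
  wp cmain r a (main_cost n f) (fun _ m =>
    SSR_L_solution J eps (select J (fun j => m j != 0))
      (select J (fun j => m (n + j)%N != 0))).
Proof.
move=> rn re.
eapply wp_weaken; [|shelve|by move=> r' m' _ _; exact: id].
apply: wp_seq; apply: (wp_load (j := n.-1)) => //.
  by rewrite /= rn -[in LHS](prednK n0) natr_subS.
apply: wp_seq; apply: (wp_load (j := n.-2)) => //.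
  by rewrite /= /upd /= rn -[2%:~R]/(2%:R) {1}nE -addn2 natrD addrK.
set r1 := upd _ _ _.
have n1 : r1 vn = n%:R by [].
have e1 : r1 veps = eps by [].
have m1 : r1 vmax = a n.-1 by [].
have a1 : r1 va = a n.-2 by [].
move: (r1) n1 e1 m1 a1 => {}r1 n1 e1 m1 a1.
apply: (wp_if (T := main_cost n f - 60)) => //=; rewrite n1 a1 m1.
case: leP => Hdom.
  eapply wp_weaken; [exact: wp_cdominant|shelve|by move=> r' m' _ _; exact: id].
eapply wp_weaken; [|shelve|by move=> r' m' _ _; exact: id].
apply: wp_seq; eapply wp_weaken; [exact: wp_csetup|exact: leqnn|].
move=> r2 _ F2 -> // [env2 lo2 hi2 i2].
have n2' : r2 vn = n%:R by rewrite F2.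
have e2 : r2 veps = eps by rewrite F2.
have m2 : r2 vmax = a n.-1 by rewrite F2.
apply: wp_seq; eapply wp_weaken; [apply: wp_csearch e2 m2 i2 env2 _ _ _|exact: leqnn|].
- by [].
- rewrite lo2 hi2; split=> //; first exact: OPT_L_ge1.
  exact: initial_feasible.
(* The initial gap is n - 1 < n <= n^2 = (eps/4)(4 n^2 / eps) <= (eps/4) B, and B < 2^f. *)
- rewrite lo2 hi2; apply: (@lt_le_trans _ _ n%:R); first by rewrite ltrBlDr ltrDl.
  have /ltW Bl := truncnS_gt (4 * n%:R * n%:R / eps).
  apply: (@le_trans _ _ (eps / 4 * (4 * n%:R * n%:R / eps))).
    have -> : eps / 4 * (4 * n%:R * n%:R / eps) = n%:R * n%:R.
      by field; rewrite gt_eqF.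
    by rewrite ler_peMr.
  rewrite ler_pM2l ?divr_gt0 //; apply: (le_trans Bl).
  by rewrite -natrX ler_nat ltnW.
move=> r3 _ F3 -> // [[lo3 lohi hin Hlo Hhi] Hgap].
have n3 : r3 vn = n%:R by rewrite F3.
have m3 : r3 vmax = a n.-1 by rewrite F3.
have i3 : r3 vi = n.-1%:R by rewrite F3.
apply: (wp_cextract _ hin _ n3 m3 i3 erefl Hlo lo3 Hgap Hhi).
  exact: le_trans lohi.
by case: env2 => ? ? ? ? ?; split=> //; rewrite F3.
Unshelve.
all: rewrite /main_cost.
all: move: (f * (n * (f * 200 + 300) + f * 200 + 500))%N.
all: move: (n * (n * (f * 400 + 600) + f * 200 + 700))%N.
all: by move: (n); clear=> u v w; rewrite /pair_cost /=; lia.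
Qed.

End MainSpec.

(** * The final program and its running time *)

Definition SSR_program : program := compile 0 cmain ++ [:: IHalt].

(** From v = 6 on, (v + 1)^4 <= 2 v^4, so the right side grows at least as fast; smaller values are
    checked one by one. *)
Lemma pow4_le_exp2 v : (v ^ 4 <= 32 * 2 ^ v)%N.
Proof.
elim: v => // v IH; rewrite (expnS 2).
have [v6|v6] := ltnP v 6; first by move: v v6 {IH}; do 6?[case=> //].
suff : (v.+1 ^ 4 <= 2 * v ^ 4)%N by move: IH; clear; lia.
rewrite !expnS expn0; nia.
Qed.

(** All monomials have degree at most 2 in each variable, and the coefficients sum to less than
    4500. *)
Lemma main_cost_le u v : (0 < u)%N -> (0 < v)%N ->
  (main_cost u v <= 45 * 100 * (u ^ 2 * v ^ 2))%N.
Proof.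
move=> u0 v0.
have h p q : (p <= 2)%N -> (q <= 2)%N -> (u ^ p * v ^ q <= u ^ 2 * v ^ 2)%N.
  by move=> p2 q2; rewrite leq_mul // leq_pexp2l.
have := h 0 0 isT isT; have := h 1 0 isT isT; have := h 0 1 isT isT.
have := h 1 1 isT isT; have := h 0 2 isT isT; have := h 2 0 isT isT.
have := h 1 2 isT isT; have := h 2 1 isT isT.
move: (u ^ 2 * v ^ 2)%N => w; rewrite /main_cost !expnS !expn0; clear; lia.
Qed.

Section TimeBound.
Variables (R : realType) (n : nat) (eps : R).
Hypotheses (n0 : (0 < n)%N) (eps01 : 0 < eps < 1).
Local Notation N := (n * (Num.truncn (4 * n%:R * n%:R / eps)).+1)%N.

(** The cost is O(n^2 f^2) with f logarithmic in N <= 5 n^3 / eps. From f^4 <= 32 * 2 N <= 324 n^4 /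
    eps follows f^2 <= 18 n^2 / sqrt eps, and 4500 * 18 = 81000. Since eps < 1, sqrt eps dominates
    eps^alpha for every alpha >= 1/2. *)
Lemma time_bound (alpha : R) : 2^-1 <= alpha ->
  (main_cost n (trunc_log 2 N).+1)%:R <= 81 * 10 ^+ 3 * n%:R ^+ 4 * (1 / eps `^ alpha).
Proof.
case/andP: eps01 => e0 e1 ha; set f := (trunc_log 2 N).+1.
have n1 : 1 <= n%:R :> R by rewrite ler1n.
have N0 : (0 < N)%N by rewrite muln_gt0 n0.
have fN : (2 ^ f <= 2 * N)%N by rewrite expnS leq_mul2l trunc_logP.
have NR : N%:R <= 5 * n%:R ^+ 3 / eps :> R.
  rewrite natrM -natr1.
  have tl : (Num.truncn (4 * n%:R * n%:R / eps))%:R <= 4 * n%:R * n%:R / eps :> R.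
    by rewrite truncn_le divr_ge0 ?mulr_ge0 ?ler0n // ltW.
  have i1 : 1 <= n%:R * n%:R / eps :> R.
    rewrite ler_pdivlMr // mul1r (le_trans (ltW e1)) //.
    by rewrite -[leLHS]mulr1 ler_pM.
  have -> : 5 * n%:R ^+ 3 / eps =
      n%:R * (4 * n%:R * n%:R / eps + n%:R * n%:R / eps) :> R by ring.
  by rewrite ler_wpM2l // lerD.
have s0 : 0 < Num.sqrt eps by rewrite sqrtr_gt0.
have sE : Num.sqrt eps ^+ 2 = eps by rewrite sqr_sqrtr // ltW.
have pw : eps `^ alpha <= Num.sqrt eps.
  by rewrite -powR12_sqrt ?(ltW e0) // ger_powR // e0 ltW.
have f2 : (f ^ 2)%:R <= 18 * n%:R ^+ 2 / Num.sqrt eps :> R.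
  rewrite -(@ler_pXn2r _ 2) ?nnegrE ?ler0n //.
  have -> : (f ^ 2)%:R ^+ 2 = (f ^ 4)%:R :> R by rewrite -natrX -expnM.
  have -> : (18 * n%:R ^+ 2 / Num.sqrt eps) ^+ 2 = 324 * (n%:R ^+ 4 / eps).
    by rewrite !exprMn exprVn sE; field; rewrite gt_eqF.
  apply: (@le_trans _ _ (32 * (2 * N))%:R).
    by rewrite ler_nat (leq_trans (pow4_le_exp2 _)) // leq_mul2l.
  rewrite !natrM; apply: (@le_trans _ _ (32 * (2 * (5 * n%:R ^+ 3 / eps)))).
    by rewrite -natrM !ler_pM2l.
  have n34 : n%:R ^+ 3 <= n%:R ^+ 4 :> R by rewrite ler_weXn2l.
  have : n%:R ^+ 3 / eps <= n%:R ^+ 4 / eps by rewrite ler_pM2r ?invr_gt0.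
  have : 0 <= n%:R ^+ 4 / eps by rewrite divr_ge0 ?exprn_ge0 // ltW.
  lra.
apply: (@le_trans _ _ (45 * 10 ^+ 2 * (n%:R ^+ 2 * (f ^ 2)%:R))).
  apply: le_trans (_ : (45 * 100 * (n ^ 2 * f ^ 2))%:R <= _).
    by rewrite ler_nat main_cost_le.
  have -> : 10 ^+ 2 = 100%:R :> R by rewrite -natrX.
  by rewrite (natrM _ (45 * 100)) (natrM _ 45) (natrM _ (n ^ 2)) (natrX _ n).
apply: (@le_trans _ _ (45 * 10 ^+ 2 * (n%:R ^+ 2 * (18 * n%:R ^+ 2 / Num.sqrt eps)))).
  by rewrite !ler_pM2l // exprn_gt0 // ltr0n.
have -> : 45 * 10 ^+ 2 * (n%:R ^+ 2 * (18 * n%:R ^+ 2 / Num.sqrt eps)) =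
   81 * 10 ^+ 3 * n%:R ^+ 4 * (1 / Num.sqrt eps) :> R by ring.
rewrite ler_wpM2l ?mulr_ge0 ?exprn_ge0 // !div1r lef_pV2 ?posrE //.
by rewrite powR_gt0.
Qed.

End TimeBound.

Theorem theorem4p15 (R : realType) :
  exists (P : program) (C : R) (k : nat),
    forall (I : {fset R}) (eps : R), SSR_L_instance I eps ->
      exists (t : nat) (s : state R),
        [/\ halts_in P (input I eps) t s,
            SSR_L_solution I eps (outputX I s) (outputY I s)
          & t%:R <= C * #|` I|%:R ^+ k *
                    (1 / eps `^ ((93 * 10 ^+ 3 + 856) / 10 ^+ 5))].
Proof.
exists SSR_program, (81 * 10 ^+ 3), 4%N => I eps [I0 n2 eps01].
set N := (#|` I| * (Num.truncn (4 * #|` I|%:R * #|` I|%:R / eps)).+1)%N.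
have Nf : (N < 2 ^ (trunc_log 2 N).+1)%N by rewrite trunc_log_ltn.
have [t [r' [m' [He Ht Hsol]]]] := wp_cmain I0 n2 eps01 Nf
  (r := reg (input I eps)) erefl erefl.
have Hcode : code_at SSR_program 0 (compile 0 cmain).
  exact: (code_at_suffix [::] (compile 0 cmain) [:: IHalt]).
have wfm : wf cmain by vm_compute.
have [r0 [Hrun _]] := compile_correct He wfm Hcode (fun i _ => erefl).
exists t, (State (0 + size (compile 0 cmain)) r0 m'); split=> //.
(* What remains is that 0.93856 is at least 1/2. *)
apply: le_trans (time_bound (ltnW n2) eps01 _); first by rewrite ler_nat.
lra.
Qed.
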